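(* Let $u_1:=u(z,c,t)$, $u_2:=u(z,-c,t)$ and $p:=\frac{u_1+u_2}{2}$. Then $p$ is a solution of the complex telegraph equation $$\frac{\partial^2p}{\partial t^2}+2\lambda\frac{\partial p}{\partial t}=-c^2\,[z^2p''+zp']=c^2\frac{\partial^2p}{\partial\theta^2},\qquad z=re^{i\theta},\ z\ne0,\ \theta\in[0,2\pi),\ 0<r<1,$$ where primes denote (complex) derivatives with respect to $z$.
   Context: Fix $\lambda,c>0$. $\{N(t)\}$ is a homogeneous Poisson process of rate $\lambda$. For $z$ in the closed unit disc $\overline{\mathbb D}$ and $v\in\{-c,c\}$, under $\mathbb E_{z,v}$ we have $V(0)=v$, $V(t)=v(-1)^{N(t)}$, $X(t)=\int_0^tV(s)\,ds$, $Z(t)=ze^{iX(t)}$. Let $f$ be a function on $\overline{\mathbb D}\times\{-c,c\}$ such that $z\mapsto f(z,v)$ is analytic in the open unit disc $\mathbb D$ and continuous on $\overline{\mathbb D}$ for each $v\in\{-c,c\}$. Put $u(z,v,t):=\mathbb E_{z,v}[f(Z(t),V(t))]$, $t\ge0$. *)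

(* Defs.v *)
From HB Require Import structures.
From mathcomp Require Import all_boot all_order all_algebra.
From mathcomp Require Import all_classical all_reals all_analysis.
From mathcomp Require Import complex.
Set Implicit Arguments.
Unset Strict Implicit.
Unset Printing Implicit Defensive.
Import Order.TTheory GRing.Theory Num.Theory.
Import numFieldNormedType.Exports.
Local Open Scope classical_set_scope.
Local Open Scope ring_scope.
Local Open Scope complex_scope.

(* Gives R[i] the norm topology of the numeric field it already is. *)
HB.instance Definition _ (R : realType) :=
  NormedModule.copy R[i] (R[i] : numFieldType).

Section complex_analysis.
Context {R : realType}.
Implicit Types (z a : R[i]) (g : R[i] -> R[i]).

Definition unit_disc : set R[i] := [set z | `|z| < 1].

Definition closed_unit_disc : set R[i] := [set z | `|z| <= 1].

Definition expi (x : R) : R[i] := cos x +i* sin x.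

(* At every point of D, g is the sum of a power series on some ball. *)
Definition analytic_on (D : set R[i]) g : Prop :=
  forall a, D a -> exists (b : nat -> R[i]) (e : R), 0 < e /\
    forall z, `|z - a| < e%:C ->
      series (fun n => b n * (z - a) ^+ n) @ \oo --> g z.

(* Complex differentiability, with derive1 taken over the field R[i]; the
   second condition is about derive1 g, meaningful by the first one. *)
Definition twice_cderivable g z : Prop :=
  (\forall w \near z, derivable g w 1) /\ derivable (derive1 g) z 1.

End complex_analysis.

(* Derivatives of complex-valued functions of a real variable, relative to a
   domain D: two-sided in the interior of D, one-sided at an end point.
   (R[i] carries no normed R-module structure, so derive1 does not apply.) *)
Section real_variable.
Context {R : realType}.
Implicit Types (D : set R) (g : R -> R[i]) (x : R).

Definition diff_quotient g x (y : R) : R[i] := (y - x)^-1%:C * (g y - g x).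

Definition rderivable D g x : Prop := cvg (diff_quotient g x @ within D x^').

Definition rderive D g x : R[i] := lim (diff_quotient g x @ within D x^').

Definition twice_rderivable D g x : Prop :=
  (\forall y \near within D (nbhs x), rderivable D g y) /\
  rderivable D (rderive D g) x.

End real_variable.

Section telegraph_process.
Context {R : realType} {d : measure_display} {T : measurableType d}.
Implicit Types (P : probability T R) (N : R -> T -> nat) (w : T).

(* Only the values N t with t >= 0 matter.  As N is nondecreasing in time, the
   truncated differences below are the true increments. *)
Record poisson_process P (lambda : R) N : Prop := PoissonProcess {
  poisson_measurable : forall t, 0 <= t -> measurable_fun setT (N t) ;
  poisson_init : forall w, N 0 w = 0%N ;
  poisson_nondecreasing : forall w s t, 0 <= s -> s <= t -> (N s w <= N t w)%N ;
  poisson_right_continuous :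
    forall w t, 0 <= t -> (fun s => N s w) @ t^'+ --> N t w ;
  poisson_independent_increments :
    forall (n : nat) (t : nat -> R) (A : nat -> set nat),
      0 <= t 0%N -> (forall i, t i <= t i.+1) ->
      P (\bigcap_(i < n) [set w | A i (N (t i.+1) w - N (t i) w)%N]) =
      (\prod_(i < n) P [set w | A i (N (t i.+1) w - N (t i) w)%N])%E ;
  poisson_increment_law : forall s t (k : nat), 0 <= s -> s < t ->
    P [set w | (N t w - N s w)%N = k] =
    (poisson_pmf (lambda * (t - s)) k)%:E
}.

Definition cexpectation P (Y : T -> R[i]) : R[i] :=
  fine 'E_P[fun w => complex.Re (Y w)] +i* fine 'E_P[fun w => complex.Im (Y w)].

Definition velocity N (v t : R) w : R := v * (-1) ^+ N t w.

Definition position N (v t : R) w : R :=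
  \int[lebesgue_measure]_(s in `[0, t]) velocity N v s w.

Definition circle_process N (z : R[i]) (v t : R) w : R[i] :=
  z * expi (position N v t w).

(* The expectation under which the process starts from (z, v). *)
Definition telegraph_mean P N (f : R[i] -> R -> R[i]) (z : R[i]) (v t : R) :
    R[i] :=
  cexpectation P (fun w => f (circle_process N z v t w) (velocity N v t w)).

End telegraph_process.

(* Main.v *)
Require Import Defs.
From mathcomp Require Import all_boot all_order all_algebra.
From mathcomp Require Import all_classical all_reals all_analysis.
From mathcomp Require Import complex measurable_realfun.
From mathcomp Require Import ring lra zify.
Import Order.TTheory GRing.Theory Num.Theory.
Import numFieldNormedType.Exports ComplexField.Normc.
Set Implicit Arguments.
Unset Strict Implicit.
Unset Printing Implicit Defensive.
Local Open Scope classical_set_scope.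
Local Open Scope ring_scope.
Local Open Scope complex_scope.

(* The process (X, V) is Markov, and conditioning on the number of jumps in
   [s, t] gives the forward equation d/dt E[g(Z, V)] = E[(L g)(Z, V)] with
   L = i v D + lambda (S - 1), where D = z d/dz and S flips the sign of v.
   Since v S = - S v, the operators satisfy L^2 + 2 lambda L = - c^2 D^2, so
   every u(z, v, .) already solves the telegraph equation; D passes through
   the expectation because Z = z e^(i X) depends linearly on z.
   The forward equation needs (X_s, V_s) to be independent of N_t - N_s: X_s is
   a limit of Riemann sums, each a function of the parities of finitely many
   increments of N.  All derivatives are obtained from quadratic Taylor bounds
   that hold uniformly along the circle |w| = |z|. *)

(** * Expectations of bounded random variables *)

(** Mere differentiability of [f] would not survive the expectation: the position is random, so the
    remainder has to be controlled on the whole circle at once. Analyticity bounds it near each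
    point of the circle, with a moving base point, and compactness then gives one constant and one
    radius. Conditioning on the jumps after [s] yields only an estimate based at the earlier time.
    The derivative from the left comes from applying the same estimate to the image of the
    observable under [L], so the observables must form a class stable under [L]. Pairs of functions
    analytic in the open disc, one for each parity of [N], are such a class. Fixing [v] and keeping
    only this parity also reduces the past of the process to finitely many bits on a grid. The
    probabilistic part deals with real observables and is applied to real and imaginary parts. *)

Section bounded_expectation.
Context {R : realType} {d : measure_display} {T : measurableType d}.
Variable P : probability T R.
Implicit Types (Y Z : T -> R) (B : set T).

(** Boundedness stands in for integrability because it is stable under products, and a probability
    measure integrates every bounded measurable function. *)
Definition bounded_rv Y := measurable_fun setT Y /\ exists K : R, forall w, `|Y w| <= K.

Local Notation E Y := (Rintegral P setT Y).

Lemma bounded_rv_integrable Y : bounded_rv Y -> P.-integrable setT (EFin \o Y).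
Proof.
move=> [mY [K YK]]; apply: measurable_bounded_integrable => //.
  by apply: le_lt_trans (ltry 1); exact: probability_le1.
exists K; split; first exact: num_real.
by move=> x Kx w _ /=; rewrite (le_trans (YK w))// ltW.
Qed.

Lemma bounded_rv_cst (a : R) : bounded_rv (fun=> a).
Proof. by split; [exact: measurable_cst | exists `|a|]. Qed.

Lemma bounded_rvD Y Z : bounded_rv Y -> bounded_rv Z -> bounded_rv (fun w => Y w + Z w).
Proof.
move=> [mY [K YK]] [mZ [L ZL]]; split; first exact: measurable_funD.
by exists (K + L) => w; rewrite (le_trans (ler_normD _ _))// lerD.
Qed.

Lemma bounded_rvM Y Z : bounded_rv Y -> bounded_rv Z -> bounded_rv (fun w => Y w * Z w).
Proof.
move=> [mY [K YK]] [mZ [L ZL]]; split; first exact: measurable_funM.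
by exists (K * L) => w; rewrite normrM ler_pM.
Qed.

Lemma bounded_rvZ (a : R) Y : bounded_rv Y -> bounded_rv (fun w => a * Y w).
Proof. by move=> bY; apply: bounded_rvM => //; exact: bounded_rv_cst. Qed.

Lemma bounded_rvN Y : bounded_rv Y -> bounded_rv (fun w => - Y w).
Proof.
by move=> /(bounded_rvZ (-1)); under eq_fun do rewrite mulN1r.
Qed.

Lemma bounded_rvB Y Z : bounded_rv Y -> bounded_rv Z -> bounded_rv (fun w => Y w - Z w).
Proof. by move=> bY bZ; apply: bounded_rvD => //; exact: bounded_rvN. Qed.

Lemma bounded_rv_norm Y : bounded_rv Y -> bounded_rv (fun w => `|Y w|).
Proof.
move=> [mY [K YK]]; split; first exact: measurableT_comp.
by exists K => w; rewrite normr_id.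
Qed.

Lemma bounded_rv_indic B : measurable B -> bounded_rv (\1_B).
Proof.
move=> mB; split; first exact: measurable_indic.
by exists 1 => w; rewrite indicE; case: (_ \in _); rewrite ?normr1 ?normr0.
Qed.

Lemma bounded_rv_sum (I : finType) (Y : I -> T -> R) :
  (forall i, bounded_rv (Y i)) -> bounded_rv (fun w => \sum_i Y i w).
Proof.
move=> bY; rewrite (_ : (fun w => _) = \sum_i Y i); last first.
  by apply/funext => w; rewrite fct_sumE.
elim/big_ind : _ => //; first exact: bounded_rv_cst.
by move=> Z1 Z2; exact: bounded_rvD.
Qed.

Lemma Rexpectation_cst (a : R) : E (fun=> a) = a.
Proof. rewrite Rintegral_cst// (_ : fine _ = 1) ?mulr1//.
by have /(congr1 fine) := probability_setT P. Qed.

Lemma RexpectationD Y Z : bounded_rv Y -> bounded_rv Z ->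
  E (fun w => Y w + Z w) = E Y + E Z.
Proof. by move=> bY bZ; apply: RintegralD => //; exact: bounded_rv_integrable. Qed.

Lemma RexpectationB Y Z : bounded_rv Y -> bounded_rv Z ->
  E (fun w => Y w - Z w) = E Y - E Z.
Proof. by move=> bY bZ; apply: RintegralB => //; exact: bounded_rv_integrable. Qed.

Lemma RexpectationZ (a : R) Y : bounded_rv Y -> E (fun w => a * Y w) = a * E Y.
Proof. by move=> bY; apply: RintegralZl => //; exact: bounded_rv_integrable. Qed.

Lemma Rexpectation_sum (I : finType) (Y : I -> T -> R) :
  (forall i, bounded_rv (Y i)) -> E (fun w => \sum_i Y i w) = \sum_i E (Y i).
Proof.
move=> bY; rewrite (_ : (fun w => _) = \sum_i Y i); last first.
  by apply/funext => w; rewrite fct_sumE.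
suff [//] : E (\sum_i Y i) = \sum_i E (Y i) /\ bounded_rv (\sum_i Y i).
elim/big_ind2 : _ => //.
- by split; [exact: Rexpectation_cst|exact: bounded_rv_cst].
- move=> Y1 e1 Y2 e2 [EY1 bY1] [EY2 bY2]; split; last exact: bounded_rvD.
  by rewrite -EY1 -EY2; exact: RexpectationD.
Qed.

Lemma le_Rexpectation Y Z : bounded_rv Y -> bounded_rv Z ->
  (forall w, Y w <= Z w) -> E Y <= E Z.
Proof.
by move=> bY bZ YZ; apply: le_Rintegral => //; exact: bounded_rv_integrable.
Qed.

Lemma normr_Rexpectation Y Z : bounded_rv Y -> bounded_rv Z ->
  (forall w, `|Y w| <= Z w) -> `|E Y| <= E Z.
Proof.
move=> bY bZ YZ; apply: le_trans (le_normr_Rintegral _ _) _ => //.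
  exact: bounded_rv_integrable.
by apply: le_Rexpectation => //; exact: bounded_rv_norm.
Qed.

Lemma Rexpectation_indic B : measurable B -> E (\1_B) = fine (P B).
Proof.
by move=> mB; rewrite /Rintegral integral_indic// setIT.
Qed.

(** Dominated convergence with a constant majorant. Measurability of the limit is part of the
    conclusion: this is how functions of the position are shown to be random variables. *)
Lemma cvg_Rexpectation (Y_ : nat -> T -> R) Y (K : R) :
  (forall n, measurable_fun setT (Y_ n)) -> (forall n w, `|Y_ n w| <= K) ->
  (forall w, Y_ ^~ w @ \oo --> Y w) ->
  bounded_rv Y /\ (fun n => E (Y_ n)) @ \oo --> E Y.
Proof.
move=> mY_ YK Ycvg.
have mY : measurable_fun setT Y by apply: measurable_fun_cvg => // w _; exact: Ycvg.
have bY : bounded_rv Y.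
  split=> //; exists K => w.
  have h : (fun n => `|Y_ n w|) @ \oo --> `|Y w| by apply: cvg_norm; exact: Ycvg.
  rewrite -(cvg_lim _ h)//; apply: limr_le; first by apply/cvg_ex; exists `|Y w|.
  by apply: nearW => n; exact: YK.
split=> //.
have [] := @dominated_convergence _ _ _ P setT measurableT
  (fun n => EFin \o Y_ n) (EFin \o Y) (EFin \o cst K).
- by move=> n; exact/measurable_EFinP.
- exact/measurable_EFinP.
- by apply: aeW => w _; apply: cvg_EFin; [exact: nearW|exact: Ycvg].
- exact/bounded_rv_integrable/bounded_rv_cst.
- by apply: aeW => w n _ /=; rewrite lee_fin.
move=> iY _ h; apply: fine_cvg; rewrite fineK//; last exact: integrable_fin_num.
Qed.

End bounded_expectation.

(** * Independence of the past and an increment *)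

Section poisson_parities.
Context {R : realType} {d : measure_display} {T : measurableType d}.
Variables (P : probability T R) (lambda : R) (N : R -> T -> nat).
Hypothesis N_poisson : poisson_process P lambda N.

Local Notation E Y := (Rintegral P setT Y).

Lemma measurable_increment (s t : R) : 0 <= s -> 0 <= t ->
  measurable_fun setT (fun w => (N t w - N s w)%N).
Proof.
by move=> s0 t0; apply: measurable_fun_subn; exact: (poisson_measurable N_poisson).
Qed.

Lemma measurable_increment_set (s t : R) (A : set nat) : 0 <= s -> 0 <= t ->
  measurable [set w | A (N t w - N s w)%N].
Proof.
move=> s0 t0; rewrite -[X in measurable X]setTI.
by have := measurable_increment s0 t0 measurableT (_ : measurable A); apply.
Qed.

(** Parities are all that the velocity sees of [N], and they take finitely many values: any function
    of them is a finite combination of indicators. *)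
Definition parities (t_ : nat -> R) n w : {ffun 'I_n -> bool} :=
  [ffun i : 'I_n => odd (N (t_ i.+1) w - N (t_ i) w)].

Section grid.
Variables (t_ : nat -> R) (n : nat).
Hypotheses (t_ge0 : 0 <= t_ 0%N) (t_nd : forall i, t_ i <= t_ i.+1).

Let t_i_ge0 i : 0 <= t_ i.
Proof. by elim: i => // i; move/le_trans; apply. Qed.

(** Indices below [n] carry a parity constraint; at [n], where [insub] fails, the set is [[set k]].
    One family thus describes the past alone ([n] factors) and the past with the next increment
    ([n.+1] factors). *)
Let A k (b : {ffun 'I_n -> bool}) i : set nat :=
  if insub i is Some j then [set m | odd m = b j] else [set k].

Let parities_bigcap k b : [set w | parities t_ n w = b] =
  \bigcap_(i < n) [set w | A k b i (N (t_ i.+1) w - N (t_ i) w)%N].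
Proof.
apply/seteqP; split => w /=.
  by move=> <- i /= ilt; rewrite /A insubT /= ffunE.
move=> h; apply/ffunP => i; rewrite ffunE; have := h i (ltn_ord i).
by rewrite /= /A valK.
Qed.

Lemma measurable_parities b : measurable [set w | parities t_ n w = b].
Proof.
rewrite (parities_bigcap 0) bigcap_mkord; apply: bigsetI_measurable => i _.
exact: measurable_increment_set.
Qed.

(** Both events are intersections over the family [A], so the product formula at [n.+1] is the one
    at [n] times its last factor. *)
Lemma parities_increment_independent k b :
  P ([set w | parities t_ n w = b] `&` [set w | (N (t_ n.+1) w - N (t_ n) w)%N = k]) =
  (P [set w | parities t_ n w = b] *
   P [set w | (N (t_ n.+1) w - N (t_ n) w)%N = k])%E.
Proof.
have AnE : A k b n = [set k] by rewrite /A insubF// ltnn.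
have -> : [set w | parities t_ n w = b] `&`
    [set w | (N (t_ n.+1) w - N (t_ n) w)%N = k] =
    \bigcap_(i < n.+1) [set w | A k b i (N (t_ i.+1) w - N (t_ i) w)%N].
  rewrite (parities_bigcap k).
  pose F i := [set w | A k b i (N (t_ i.+1) w - N (t_ i) w)%N].
  by rewrite (bigcap_mkord n F) (bigcap_mkord n.+1 F) big_ord_recr/= /F AnE.
have h := poisson_independent_increments N_poisson _ (A k b) t_ge0 t_nd.
by rewrite (h n.+1) big_ord_recr/= -(h n) -parities_bigcap AnE.
Qed.

Variable G : {ffun 'I_n -> bool} -> R.

Let GE w : G (parities t_ n w) =
  \sum_b G b * \1_[set w | parities t_ n w = b] w.
Proof.
rewrite (bigD1 (parities t_ n w))//= indicE mem_set// mulr1 big1 ?addr0// => b.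
by move=> /eqP bw; rewrite indicE memNset ?mulr0//= => /esym.
Qed.

Lemma bounded_rv_parities : bounded_rv (fun w => G (parities t_ n w)).
Proof.
under eq_fun do rewrite GE.
apply: bounded_rv_sum => b; apply: bounded_rvZ.
by apply: bounded_rv_indic; exact: measurable_parities.
Qed.

Lemma parities_increment_expectation k :
  let B := [set w | (N (t_ n.+1) w - N (t_ n) w)%N = k] in
  E (fun w => G (parities t_ n w) * \1_B w) =
  fine (P B) * E (fun w => G (parities t_ n w)).
Proof.
move=> B; have mB : measurable B by exact: (@measurable_increment_set _ _ [set k]).
have bG b : bounded_rv (\1_[set w | parities t_ n w = b] : T -> R).
  by apply: bounded_rv_indic; exact: measurable_parities.
under eq_Rintegral do rewrite GE.
under [in RHS]eq_Rintegral do rewrite GE.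
rewrite (Rexpectation_sum P (Y := fun b w => G b * \1_[set w | parities t_ n w = b] w)); last first.
  by move=> b; exact: bounded_rvZ.
under eq_Rintegral do rewrite mulr_suml.
rewrite (Rexpectation_sum P (Y := fun b w => G b * \1_[set w | parities t_ n w = b] w * \1_B w)); last first.
  by move=> b; apply: bounded_rvM; [exact: bounded_rvZ|exact: bounded_rv_indic].
rewrite mulr_sumr; apply: eq_bigr => b _.
under eq_Rintegral do rewrite -mulrA.
rewrite RexpectationZ; last by apply: bounded_rvM => //; exact: bounded_rv_indic.
rewrite RexpectationZ// mulrCA; congr (_ * _).
under eq_Rintegral do rewrite -[_ * _]/((\1__ \* \1__) _) -indicI.
have mb := measurable_parities b.
rewrite !Rexpectation_indic//; last exact: measurableI.
rewrite parities_increment_independent fineM 1?mulrC//; exact: fin_num_measure.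
Qed.

End grid.
End poisson_parities.

(** * Pathwise estimates for the position and its Riemann sums *)

Section position.
Context {R : realType} {d : measure_display} {T : measurableType d}.
Variables (P : probability T R) (lambda : R) (N : R -> T -> nat).
Hypothesis N_poisson : poisson_process P lambda N.
Variables (v : R).

Local Notation E Y := (Rintegral P setT Y).
Local Notation V := (velocity N v).
Local Notation X := (position N v).

(** Writes the sign through a continuous function, so that measurability of the velocity in time
    reduces to that of [N], which is monotone. *)
Lemma cos_pi_nat (n : nat) : cos (pi * n%:R) = (-1) ^+ n :> R.
Proof.
elim: n => [|n IH]; first by rewrite mulr0 cos0 expr0.
by rewrite -natr1 mulrDr mulr1 cosDpi IH exprS mulN1r.
Qed.

Lemma velocityE (t : R) w : V t w = v * (-1) ^+ odd (N t w).
Proof. by rewrite /velocity signr_odd. Qed.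

Lemma normr_velocity (t : R) w : `|V t w| = `|v|.
Proof. by rewrite /velocity normrM normrX normrN1 expr1n mulr1. Qed.

Lemma velocity_integrable w (D : set R) : measurable D -> D `<=` [set s | 0 <= s] ->
  (lebesgue_measure D < +oo)%E ->
  lebesgue_measure.-integrable D (EFin \o (fun s : R => V s w)).
Proof.
move=> mD D0 Dfin; apply: measurable_bounded_integrable => //; last first.
  by exists `|v|; split => [|K vK s _ /=]; rewrite ?num_real// normr_velocity ltW.
(* Monotonicity of [N] is known only for nonnegative times; cutting at 0 makes [M] monotone on the
   whole line without changing it on [D]. *)
pose M s : R := (N (Num.max 0 s) w)%:R.
apply: (@eq_measurable_fun _ _ _ _ _ (fun s => v * cos (pi * M s))).
  move=> s; rewrite inE => /D0 /= s0.
  by rewrite cos_pi_nat /velocity max_r.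
apply: measurable_funM => //; apply: measurableT_comp.
  by apply: continuous_measurable_fun; exact: continuous_cos.
apply: measurable_funM => //; apply: nondecreasing_measurable => // x y xy.
rewrite ler_nat; apply: (poisson_nondecreasing N_poisson).
  by rewrite le_max lexx.
by rewrite ge_max !le_max lexx/= xy orbT.
Qed.

Lemma position0 w : X 0 w = 0.
Proof. by rewrite /position set_itv1 Rintegral_set1. Qed.

(** Common source of the pathwise bounds. With [k] the velocity at [a], [B] is 0 if nothing jumps
    and twice the speed otherwise; [k = 0] with [B] the speed gives the Lipschitz bound. *)
Lemma position_increment (a b k B : R) w : 0 <= a -> a <= b ->
  (forall s, a <= s <= b -> `|V s w - k| <= B) ->
  `|X b w - X a w - (b - a) * k| <= B * (b - a).
Proof.
move=> a0 ab VkB.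
have iab : lebesgue_measure.-integrable `]a, b] (EFin \o (fun s : R => V s w)).
  apply: velocity_integrable => //=; last by rewrite lebesgue_measure_itv/=; case: ifP => _; rewrite ltry.
  by move=> s /=; rewrite in_itv/= => /andP[/ltW as_ _]; exact: le_trans as_.
have icst (r : R) : lebesgue_measure.-integrable `]a, b] (EFin \o (fun _ : R => r)).
  apply: measurable_bounded_integrable => //=.
    by rewrite lebesgue_measure_itv/=; case: ifP => _; rewrite ltry.
  by exists `|r|; split => [|M rM s _ /=]; rewrite ?num_real// ltW.
have len : fine (lebesgue_measure (`]a, b]%classic : set R)) = b - a.
  rewrite lebesgue_measure_itv/= lte_fin; case: ltP => //= ba.
  by apply/esym/eqP; rewrite subr_eq0 eq_le ba ab.
rewrite /position Rintegral_itvB ?bnd_simp//; last first.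
  apply: velocity_integrable => //=; last by rewrite lebesgue_measure_itv/=; case: ifP => _; rewrite ltry.
  by move=> s /=; rewrite in_itv/= => /andP[].
have -> : (b - a) * k = \int[lebesgue_measure]_(s in `]a, b]) k.
  by rewrite Rintegral_cst//= len mulrC.
rewrite -RintegralB//=.
apply: le_trans (le_normr_Rintegral _ _) _ => //=.
  by have := integrableB _ iab (icst k); apply.
rewrite -len -Rintegral_cst//=; apply: le_Rintegral => //=.
  rewrite (_ : EFin \o _ = abse \o (EFin \o (fun s => V s w - k)))//.
  apply: integrable_abse => //.
  by have := integrableB _ iab (icst k); apply.
by move=> s; rewrite in_itv/= => /andP[/ltW ? ?]; apply: VkB; apply/andP.
Qed.

Lemma position_no_jump (a b : R) w : 0 <= a -> a <= b -> N a w = N b w ->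
  X b w = X a w + (b - a) * V a w.
Proof.
move=> a0 ab Nab; apply/eqP; rewrite -subr_eq0 opprD addrA -normr_le0.
rewrite -(mul0r (b - a)); apply: position_increment => // s /andP[as_ sb].
rewrite /velocity (_ : N s w = N a w) ?subrr ?normr0//.
apply/eqP; rewrite eqn_leq [X in (_ <= X)%N]Nab.
by rewrite !(poisson_nondecreasing N_poisson)// (le_trans a0).
Qed.

Lemma position_lipschitz (a b : R) w : 0 <= a -> a <= b ->
  `|X b w - X a w| <= `|v| * (b - a).
Proof.
move=> a0 ab; rewrite -[X b w - _]subr0 -[0](mulr0 (b - a)).
by apply: position_increment => // s _; rewrite subr0 normr_velocity.
Qed.

(** The left side vanishes without a jump; otherwise the number of jumps is at least 1. Keeping that
    number as a factor makes the bounds telescope over a grid. *)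
Lemma position_jump (a b : R) w : 0 <= a -> a <= b ->
  `|X b w - X a w - (b - a) * V a w| <=
  2 * `|v| * (b - a) * ((N b w)%:R - (N a w)%:R).
Proof.
move=> a0 ab; have := poisson_nondecreasing N_poisson w a0 ab.
rewrite leq_eqVlt => /predU1P[Nab|Nab].
  rewrite (position_no_jump a0 ab Nab) Nab subrr mulr0.
  by rewrite addrAC addrK subrr normr0.
apply: (@le_trans _ _ (2 * `|v| * (b - a))); last first.
  rewrite ler_peMr ?mulr_ge0 ?subr_ge0//.
  by rewrite lerBrDl natr1 ler_nat.
apply: position_increment => // s _; rewrite (le_trans (ler_normB _ _))//.
by rewrite !normr_velocity mulr2n mulrDl mul1r.
Qed.

Definition riemann_position (t : R) n w : R :=
  \sum_(i < n.+1) t / n.+1%:R * V (t * i%:R / n.+1%:R) w.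

Lemma riemann_position_error (t : R) n w : 0 <= t ->
  `|X t w - riemann_position t n w| <= 2 * `|v| * (t / n.+1%:R) * (N t w)%:R.
Proof.
move=> t0; set h := t / n.+1%:R; have h0 : 0 <= h by rewrite divr_ge0.
have hE i : t * i%:R / n.+1%:R = h * i%:R by rewrite mulrAC.
(* Induction along the grid: each cell adds an error proportional to its own number of jumps, and
   these numbers add up to [N t w]. *)
suff H m : `|X (h * m%:R) w - \sum_(i < m) h * V (h * i%:R) w|
    <= 2 * `|v| * h * (N (h * m%:R) w)%:R.
  have := H n.+1; rewrite {1 4}/h divfK ?pnatr_eq0//.
  by rewrite /riemann_position; under eq_bigr do rewrite -hE.
elim: m => [|m IH].
  rewrite mulr0 position0 big_ord0 subrr normr0.
  by rewrite !mulr_ge0.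
rewrite big_ord_recr/=.
have hm0 : 0 <= h * m%:R by rewrite mulr_ge0.
have hmS : h * m.+1%:R - h * m%:R = h by rewrite -mulrBr -natr1 addrAC subrr add0r mulr1.
have hm : h * m%:R <= h * m.+1%:R by rewrite -subr_ge0 hmS.
have := position_jump w hm0 hm; rewrite hmS => J.
set a := X (h * m.+1%:R) w in J *; set b := X (h * m%:R) w in IH J.
set S := \sum_(i < m) _ in IH *; set y := h * V _ w in J *.
have -> : a - (S + y) = (b - S) + (a - b - y) by ring.
rewrite (le_trans (ler_normD _ _))// (le_trans (lerD IH J))//.
by rewrite -mulrDr addrC subrK.
Qed.

Lemma riemann_position_cvg (t : R) w : 0 <= t ->
  riemann_position t ^~ w @ \oo --> X t w.
Proof.
move=> t0; apply/cvgrPdist_le => e e0; near=> n.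
rewrite (le_trans (riemann_position_error _ _ t0))//.
have -> : 2 * `|v| * (t / n.+1%:R) * (N t w)%:R =
   (2 * `|v| * t * (N t w)%:R) / n.+1%:R by rewrite !mulrA; ring.
rewrite ler_pdivrMr ?ltr0n// -ler_pdivrMl// (@le_trans _ _ n%:R) ?ler_nat//.
by near: n; exact: nbhs_infty_ger.
Unshelve. all: by end_near. Qed.

End position.

(** * From parities on a grid to the state of the process *)

Section independence.
Context {R : realType} {d : measure_display} {T : measurableType d}.
Variables (P : probability T R) (lambda : R) (N : R -> T -> nat).
Hypothesis N_poisson : poisson_process P lambda N.
Variables (v : R).

Local Notation E Y := (Rintegral P setT Y).
Local Notation V := (velocity N v).
Local Notation X := (position N v).

(** Adding increments is exclusive or on parities; as [N] starts at 0, this recovers the parity of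
    [N] at each grid time. *)
Definition prefix_parity n (b : {ffun 'I_n -> bool}) (i : nat) : bool :=
  \big[addb/false]_(j < n | (j < i)%N) b j.

Lemma prefix_parity_parities (t_ : nat -> R) n i w :
  t_ 0%N = 0 -> (forall i, t_ i <= t_ i.+1) -> (i <= n)%N ->
  prefix_parity (parities N t_ n w) i = odd (N (t_ i) w).
Proof.
move=> t00 t_nd ilen; rewrite /prefix_parity.
under eq_bigr do rewrite ffunE.
rewrite -(big_ord_widen _ (fun j : nat => odd (N (t_ j.+1) w - N (t_ j) w))%N)//.
have t_ge0 m : 0 <= t_ m by elim: m => [|m]; [rewrite t00|move/le_trans; apply].
elim: i {ilen} => [|i IH]; first by rewrite big_ord0 t00 (poisson_init N_poisson).
rewrite big_ord_recr/= IH oddB; first by rewrite addbC addbK.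
by apply: (poisson_nondecreasing N_poisson).
Qed.

Lemma telegraph_state_independent (phi : bool -> R -> R) (K s t : R) k :
  (forall b, continuous (phi b)) -> (forall b x, `|phi b x| <= K) ->
  0 <= s -> s <= t ->
  let Y w := phi (odd (N s w)) (X s w) in
  let B := [set w | (N t w - N s w)%N = k] in
  bounded_rv Y /\ E (fun w => Y w * \1_B w) = fine (P B) * E Y.
Proof.
move=> phi_cont phiK s0 st Y B.
(* The [n.+1] equal cells of [[0, s]] end at [s], so the increment of index [n.+1] is the one over
   [[s, t]]; beyond it the grid stays at [t], which keeps it monotone. *)
pose grid n i : R := if (i <= n.+1)%N then s * i%:R / n.+1%:R else t.
have grid0 n : grid n 0%N = 0 by rewrite /grid/= mulr0 mul0r.
have gridS n : grid n n.+1 = s by rewrite /grid leqnn mulfK ?pnatr_eq0.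
have gridT n : grid n n.+2 = t by rewrite /grid ltnn.
have grid_nd n i : grid n i <= grid n i.+1.
  rewrite /grid; case: (ltnP i n.+1) => [iltn|nlei].
    by rewrite ltnW// ler_pM2r ?invr_gt0// ler_wpM2l// ler_nat.
  case: ifP => // ilen; rewrite (_ : i = n.+1) ?mulfK ?pnatr_eq0//.
  by apply/eqP; rewrite eqn_leq ilen.
pose G n (b : {ffun 'I_n.+1 -> bool}) : R := phi (prefix_parity b n.+1)
  (\sum_(i < n.+1) s / n.+1%:R * (v * (-1) ^+ prefix_parity b i)).
pose Y_ n w := G n (parities N (grid n) n.+1 w).
have Y_E n w : Y_ n w = phi (odd (N s w)) (riemann_position N v s n w).
  rewrite /Y_ /G prefix_parity_parities// gridS; congr (phi _ _).
  apply: eq_bigr => i _; rewrite prefix_parity_parities// ?velocityE; last exact: ltnW.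
  by rewrite /grid ltnW.
have bY_ n : bounded_rv (Y_ n).
  by apply: (bounded_rv_parities N_poisson) => //; rewrite grid0.
have Y_K n w : `|Y_ n w| <= K by exact: phiK.
have Y_cvg w : Y_ ^~ w @ \oo --> Y w.
  under eq_fun do rewrite Y_E.
  by apply: continuous_cvg; [exact: phi_cont|exact: (riemann_position_cvg N_poisson)].
have [bY EY] := cvg_Rexpectation P (fun n => (bY_ n).1) Y_K Y_cvg.
split => //.
have mB : measurable B.
  by apply: (measurable_increment_set N_poisson [set k]) => //; exact: le_trans st.
have b1 : bounded_rv (\1_B : T -> R) by exact: bounded_rv_indic.
have [_ EYB] : bounded_rv (fun w => Y w * \1_B w) /\
    (fun n => E (fun w => Y_ n w * \1_B w)) @ \oo --> E (fun w => Y w * \1_B w).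
  apply: (cvg_Rexpectation P (K := K)).
  - by move=> n; case: (bounded_rvM (bY_ n) b1).
  - move=> n w; rewrite normrM -[leRHS]mulr1 ler_pM//.
    by rewrite indicE; case: (_ \in _); rewrite ?normr1 ?normr0.
  - by move=> w; apply: cvgM; [exact: Y_cvg|exact: cvg_cst].
(* The factorization is exact for each [n]; uniqueness of the limit transfers it to [Y]. *)
have : (fun n => E (fun w => Y_ n w * \1_B w)) @ \oo --> fine (P B) * E Y.
  have -> : (fun n => E (fun w => Y_ n w * \1_B w)) = (fun n => fine (P B) * E (Y_ n)).
    apply/funext => n.
    have := parities_increment_expectation N_poisson _ (grid_nd n) (G n) k.
    by rewrite gridS gridT; apply; rewrite grid0.
  by apply: cvgM; [exact: cvg_cst|exact: EY].
by apply: cvg_unique EYB.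
Qed.

End independence.

(** * The forward equation *)

Section generator.
Context {R : realType} {d : measure_display} {T : measurableType d}.
Variables (P : probability T R) (lambda : R) (N : R -> T -> nat).
Hypotheses (lambda_gt0 : 0 < lambda) (N_poisson : poisson_process P lambda N).
Variables (v : R).
Implicit Types h dh : bool -> R -> R.

Local Notation E Y := (Rintegral P setT Y).
Local Notation V := (velocity N v).
Local Notation X := (position N v).

(* Observables take the parity of [N t], which encodes the velocity, and the
   position. *)
Definition state_fun h := (forall b, continuous (h b)) /\ exists K : R, forall b x, `|h b x| <= K.

(** The remainder bound is global in [y], with one constant: the displacement of [X] is random, and
    no smallness condition on it has to be tracked. *)
Definition state_deriv h dh := [/\ state_fun h, state_fun dh &
  exists K : R, forall b x y, `|h b (x + y) - h b x - y * dh b x| <= K * y ^+ 2].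

Definition state_mean h (t : R) : R := E (fun w => h (odd (N t w)) (X t w)).

Definition state_generator h dh (b : bool) (x : R) : R :=
  v * (-1) ^+ b * dh b x + lambda * (h (~~ b) x - h b x).

Lemma bounded_rv_state h (t : R) : state_fun h -> 0 <= t ->
  bounded_rv (fun w => h (odd (N t w)) (X t w)).
Proof.
move=> [hc [K hK]] t0.
by have [] := telegraph_state_independent N_poisson v 0 hc hK t0 (lexx t).
Qed.

Lemma state_fun_generator h dh : state_fun h -> state_fun dh ->
  state_fun (state_generator h dh).
Proof.
move=> [hc [K hK]] [dhc [L dhL]]; split.
  move=> b x; rewrite /state_generator; apply: cvgD.
    by apply: cvgM; [exact: cvg_cst|exact: dhc].
  by apply: cvgM; [exact: cvg_cst|apply: cvgB; exact: hc].
exists (`|v| * L + lambda * (K + K)) => b x.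
rewrite (le_trans (ler_normD _ _))// lerD//.
  by rewrite !normrM normrX normrN1 expr1n mulr1 ler_wpM2l.
rewrite normrM gtr0_norm// ler_wpM2l ?(ltW lambda_gt0)//.
by rewrite (le_trans (ler_normB _ _))// lerD.
Qed.

(** With [e = expR (- mu)], the probabilities of 0 and 1 jump are [e] and [mu * e], and all follows
    from [1 - mu <= e <= 1]. The bounds concern at least one jump, at least two, and exactly one. *)
Lemma increment_probability (s t : R) : 0 <= s -> s < t ->
  let p k := fine (P [set w | (N t w - N s w)%N = k]) in
  let mu := lambda * (t - s) in
  [/\ 1 - p 0%N <= mu, 1 - p 0%N - p 1%N <= mu ^+ 2 & `|p 1%N - mu| <= mu ^+ 2].
Proof.
move=> s0 st p mu.
have mu0 : 0 < mu by rewrite mulr_gt0// subr_gt0.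
have pE k : p k = poisson_pmf mu k.
  by rewrite /p (poisson_increment_law N_poisson).
have e1 : 1 - mu <= expR (- mu) by exact: expR_ge1Dx.
have e2 : expR (- mu) <= 1 by rewrite -expR0 ler_expR oppr_le0 ltW.
rewrite !pE /poisson_pmf mu0 expr0 expr1 fact0 factS fact0 muln1 invr1 !mulr1 mul1r.
set e := expR _ in e1 e2 *.
split; first by lra.
  nra.
rewrite distrC ger0_norm; nra.
Qed.

(** Only the one-jump term needs independence: there a function of the state at [s] multiplies an
    indicator of the increment. All other terms are bounded outcome by outcome before taking
    expectations. *)
Lemma state_mean_forward h dh : state_deriv h dh -> exists C : R, forall s t : R,
  0 <= s -> s <= t ->
  `|state_mean h t - state_mean h s -
    (t - s) * state_mean (state_generator h dh) s| <= C * (t - s) ^+ 2.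
Proof.
move=> [[hc [K0 hK0]] [dhc [K1 dhK1]] [K2 hK2]].
pose K := Num.max K0 (Num.max K1 K2).
have hK b x : `|h b x| <= K by rewrite le_max hK0.
have dhK b x : `|dh b x| <= K by rewrite !le_max dhK1 orbT.
have h2K b x y : `|h b (x + y) - h b x - y * dh b x| <= K * y ^+ 2.
  by rewrite (le_trans (hK2 _ _ _))// ler_wpM2r ?sqr_ge0// !le_max lexx !orbT.
have K_ge0 : 0 <= K by rewrite (le_trans _ (hK true 0)).
have sh : state_fun h by split=> //; exists K.
have sdh : state_fun dh by split=> //; exists K.
(* In order: Taylor remainder of the position; first-order displacement when there is a jump; two or
   more jumps; replacement of [p 1] by [lambda * (t - s)]. *)
exists (K * v ^+ 2 + 2 * K * `|v| * lambda + 2 * K * lambda ^+ 2 +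
  lambda ^+ 2 * (2 * K)) => s t s0.
rewrite le_eqVlt => /predU1P[->|st].
  by rewrite !subrr mul0r subr0 expr0n/= mulr0 normr0.
set dt := t - s; have dt0 : 0 < dt by rewrite subr_gt0.
have t0 : 0 <= t by rewrite (le_trans s0)// ltW.
have [p01 p02 p1] := increment_probability s0 st.
set p : nat -> R := fun k => fine (P [set w | (N t w - N s w)%N = k]).
pose B k := [set w | (N t w - N s w)%N = k].
have mB k : measurable (B k) by exact: (measurable_increment_set N_poisson [set k]).
have b1 k : bounded_rv (\1_(B k) : T -> R) by exact: bounded_rv_indic.
have EB k : E (\1_(B k) : T -> R) = p k by rewrite Rexpectation_indic.
pose phi b x : R := h (~~ b) x - h b x.
have phi_cont b : continuous (phi b) by move=> x; apply: cvgB; exact: hc.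
have phiK b x : `|phi b x| <= 2 * K.
  by rewrite (le_trans (ler_normB _ _))// mulr2n mulrDl mul1r lerD.
have [bphi Ephi] := telegraph_state_independent N_poisson v 1 phi_cont phiK s0 (ltW st).
have bdh : bounded_rv (fun w => V s w * dh (odd (N s w)) (X s w)).
  have [] // := telegraph_state_independent N_poisson v 1
    (phi := fun b x => v * (-1) ^+ b * dh b x) (K := `|v| * K) _ _ s0 (ltW st).
  - by move=> b x; apply: cvgM; [exact: cvg_cst|exact: dhc].
  - by move=> b x; rewrite !normrM normrX normrN1 expr1n mulr1 ler_wpM2l.
  - by move=> + _; under eq_fun do rewrite -velocityE.
have bt := bounded_rv_state sh t0; have bs := bounded_rv_state sh s0.
pose D w := h (odd (N t w)) (X t w) - h (odd (N s w)) (X s w)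
  - dt * (V s w * dh (odd (N s w)) (X s w))
  - phi (odd (N s w)) (X s w) * \1_(B 1%N) w.
(* [D w] is O(dt^2) without jump, O(dt) with one jump, O(1) otherwise. *)
pose Z w := K * v ^+ 2 * dt ^+ 2 + (2 * K * `|v| * dt * (1 - \1_(B 0%N) w) +
  2 * K * (1 - \1_(B 0%N) w - \1_(B 1%N) w)).
have bphi1 : bounded_rv (fun w => phi (odd (N s w)) (X s w) * \1_(B 1%N) w).
  exact: bounded_rvM.
have bD : bounded_rv D.
  by do 2 (apply: bounded_rvB => //); [exact: bounded_rvB|exact: bounded_rvZ].
have b10 : bounded_rv (fun w => 1 - \1_(B 0%N) w : R).
  by apply: bounded_rvB => //; exact: bounded_rv_cst.
have b101 : bounded_rv (fun w => 1 - \1_(B 0%N) w - \1_(B 1%N) w : R).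
  exact: bounded_rvB.
have bZ12 : bounded_rv (fun w => 2 * K * `|v| * dt * (1 - \1_(B 0%N) w) +
  2 * K * (1 - \1_(B 0%N) w - \1_(B 1%N) w)).
  by apply: bounded_rvD; exact: bounded_rvZ.
have bZ : bounded_rv Z by apply: bounded_rvD => //; exact: bounded_rv_cst.
have DZ w : `|D w| <= Z w.
  have Nst := poisson_nondecreasing N_poisson w s0 (ltW st).
  have XL := position_lipschitz N_poisson v w s0 (ltW st).
  have Vdh : `|dt * (V s w * dh (odd (N s w)) (X s w))| <= K * `|v| * dt.
    rewrite normrM normrM normr_velocity gtr0_norm// [leRHS]mulrC ler_pM2l// mulrC.
    by rewrite ler_wpM2r.
  case En : (N t w - N s w)%N => [|[|n]].
  - have Nts : N s w = N t w.
      by apply/eqP; rewrite eqn_leq Nst -subn_eq0 En eqxx.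
    have i0 : \1_(B 0%N) w = 1 :> R by rewrite indicE mem_set.
    have i1 : \1_(B 1%N) w = 0 :> R by rewrite indicE memNset// /B/= En.
    rewrite /D /Z i0 i1 !subrr !mulr0 !addr0 -Nts !subr0.
    rewrite (position_no_jump N_poisson v s0 (ltW st) Nts).
    rewrite mulrA (le_trans (h2K _ _ _))// -mulrA ler_wpM2l// exprMn mulrC.
    by rewrite -[V s w ^+ 2]real_normK ?num_real// normr_velocity real_normK ?num_real.
  - have Nts : odd (N t w) = ~~ odd (N s w).
      by rewrite -(subnK Nst) En oddD.
    have i0 : \1_(B 0%N) w = 0 :> R by rewrite indicE memNset// /B/= En.
    have i1 : \1_(B 1%N) w = 1 :> R by rewrite indicE mem_set.
    rewrite /D /Z i0 i1 Nts /phi !subr0 !mulr1 subrr mulr0 addr0.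
    set b := odd _ in Vdh *; set x := X s w in XL Vdh *; set y := X t w in XL *.
    have := h2K (~~ b) x (y - x); rewrite (addrC x) subrK => T1.
    have T2 : `|(y - x) * dh (~~ b) x| <= K * `|v| * dt.
      by rewrite normrM -mulrA mulrC ler_pM.
    have T3 : (y - x) ^+ 2 <= v ^+ 2 * dt ^+ 2.
      rewrite -exprMn -[leLHS]real_normK ?num_real// -[leRHS]real_normK ?num_real//.
      by rewrite ler_pXn2r ?nnegrE// normrM (gtr0_norm dt0).
    have T4 : K * (y - x) ^+ 2 <= K * v ^+ 2 * dt ^+ 2 by rewrite -mulrA ler_wpM2l.
    set A := dt * _ in Vdh *.
    (* The jump is charged at the old position [x]. What is left is a Taylor remainder at the
       flipped parity and two terms of size at most [K * |v| * dt]. *)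
    have -> : h (~~ b) y - h b x - A - (h (~~ b) x - h b x) =
      (h (~~ b) y - h (~~ b) x - (y - x) * dh (~~ b) x) + ((y - x) * dh (~~ b) x - A).
      by ring.
    rewrite (le_trans (ler_normD _ _))// lerD//; first exact: le_trans T4.
    rewrite (le_trans (ler_normB _ _))// (le_trans (lerD T2 Vdh))//.
    by rewrite le_eqVlt; apply/orP; left; apply/eqP; ring.
  - have i0 : \1_(B 0%N) w = 0 :> R by rewrite indicE memNset// /B/= En.
    have i1 : \1_(B 1%N) w = 0 :> R by rewrite indicE memNset// /B/= En.
    rewrite /D /Z i0 i1 !subr0 !mulr0 !mulr1 subr0.
    rewrite (le_trans (ler_normB _ _))//.
    have T1 : 0 <= K * v ^+ 2 * dt ^+ 2 by do 2 (rewrite mulr_ge0 ?sqr_ge0 //).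
    have T2 := le_trans (ler_normB _ _) (lerD (hK (odd (N t w)) (X t w)) (hK (odd (N s w)) (X s w))).
    have T3 : 0 <= K * `|v| * dt by rewrite !mulr_ge0// ltW.
    by move: (lerD T2 Vdh) T1 T3; rewrite -!mulrA; lra.
have EZ : E Z = K * v ^+ 2 * dt ^+ 2 + (2 * K * `|v| * dt * (1 - p 0%N) +
  2 * K * (1 - p 0%N - p 1%N)).
  rewrite RexpectationD//; last exact: bounded_rv_cst.
  rewrite Rexpectation_cst RexpectationD ?RexpectationZ//; try exact: bounded_rvZ.
  rewrite (RexpectationB P b10)// RexpectationB//; last exact: bounded_rv_cst.
  by rewrite !EB Rexpectation_cst.
have ED : E D = state_mean h t - state_mean h s
    - dt * E (fun w => V s w * dh (odd (N s w)) (X s w))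
    - p 1%N * E (fun w => phi (odd (N s w)) (X s w)).
  rewrite RexpectationB//; last first.
    by apply: bounded_rvB; [exact: bounded_rvB|exact: bounded_rvZ].
  rewrite Ephi; congr (_ - _).
  rewrite RexpectationB; [|exact: bounded_rvB|exact: bounded_rvZ].
  by rewrite RexpectationB// RexpectationZ.
have EG : state_mean (state_generator h dh) s =
    E (fun w => V s w * dh (odd (N s w)) (X s w)) +
    lambda * E (fun w => phi (odd (N s w)) (X s w)).
  rewrite /state_mean /state_generator; under eq_Rintegral do rewrite -velocityE.
  by rewrite RexpectationD ?RexpectationZ//; exact: bounded_rvZ.
have EphiK : `|E (fun w => phi (odd (N s w)) (X s w))| <= 2 * K.
  rewrite -(Rexpectation_cst P (2 * K)); apply: normr_Rexpectation => //.
  exact: bounded_rv_cst.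
have := normr_Rexpectation P bD bZ DZ; rewrite EZ ED EG.
set e1 := E _ in EphiK *; set e2 := E _; set m1 := state_mean h t; set m2 := state_mean h s.
move=> H; have -> : m1 - m2 - dt * (e2 + lambda * e1) =
   (m1 - m2 - dt * e2 - p 1%N * e1) + (p 1%N - lambda * dt) * e1 by ring.
rewrite (le_trans (ler_normD _ _))//.
have T1 : `|(p 1%N - lambda * dt) * e1| <= (lambda * dt) ^+ 2 * (2 * K).
  by rewrite normrM ler_pM.
have T2 : 2 * K * `|v| * dt * (1 - p 0%N) <= 2 * K * `|v| * dt * (lambda * dt).
  by rewrite ler_wpM2l// !mulr_ge0// ltW.
have T3 : 2 * K * (1 - p 0%N - p 1%N) <= 2 * K * (lambda * dt) ^+ 2.
  by rewrite ler_wpM2l// mulr_ge0.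
apply: le_trans (lerD H T1) _.
apply: le_trans (lerD (lerD (lexx _) (lerD T2 T3)) (lexx _)) _.
by rewrite le_eqVlt; apply/orP; left; apply/eqP; ring.
Qed.

Lemma state_mean_bounded h : state_fun h ->
  exists C : R, forall t : R, 0 <= t -> `|state_mean h t| <= C.
Proof.
move=> sh; have [_ [K hK]] := sh; exists K => t t0.
rewrite -(Rexpectation_cst P K); apply: normr_Rexpectation => //.
  exact: bounded_rv_state.
exact: bounded_rv_cst.
Qed.

(** For [t < s] the forward estimate is based at [t]. Moving the base point to [s] costs [s - t]
    times the variation of the mean of the generator, which the forward estimate for the generator
    makes of order [s - t]; distance at most 1 absorbs its quadratic term. *)
Lemma state_mean_two_sided h dh dg :
  state_deriv h dh -> state_deriv (state_generator h dh) dg ->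
  exists C : R, forall s t : R, 0 <= s -> 0 <= t -> `|t - s| <= 1 ->
  `|state_mean h t - state_mean h s -
    (t - s) * state_mean (state_generator h dh) s| <= C * (t - s) ^+ 2.
Proof.
move=> hdh gdg; have [C1 H1] := state_mean_forward hdh.
have [C2 H2] := state_mean_forward gdg.
have [sg sdg _] := gdg.
have [C3 H3] := state_mean_bounded (state_fun_generator sg sdg).
have C1_ge0 : 0 <= C1.
  by have := H1 0 1 (lexx 0) ler01; rewrite subr0 expr1n mulr1; exact: le_trans.
have C2_ge0 : 0 <= C2.
  by have := H2 0 1 (lexx 0) ler01; rewrite subr0 expr1n mulr1; exact: le_trans.
have C3_ge0 : 0 <= C3 by rewrite (le_trans _ (H3 0 (lexx 0))).
exists (C1 + (C2 + C3)) => s t s0 t0 ts1; have [st|/ltW ts] := leP s t.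
  by rewrite (le_trans (H1 _ _ s0 st))// ler_wpM2r ?sqr_ge0// lerDl addr_ge0.
have := H1 _ _ t0 ts; have := H2 _ _ t0 ts; have := H3 _ t0.
set a := state_mean h s; set b := state_mean h t.
set ga := state_mean _ s; set gg := state_mean _ t; set gb := state_mean _ t.
set e := s - t; have -> : t - s = - e by rewrite opprB.
have e0 : 0 <= e by rewrite subr_ge0.
have e1 : e <= 1 by rewrite -(ger0_norm e0) distrC.
rewrite sqrrN => G3 G2 G1.
have G4 : `|ga - gb| <= (C2 + C3) * e.
  have -> : ga - gb = (ga - gb - e * gg) + e * gg by ring.
  rewrite [leRHS]mulrDl (le_trans (ler_normD _ _))// lerD//.
    by rewrite (le_trans G2)// ler_wpM2l// expr2 ler_piMl.
  by rewrite normrM ger0_norm// mulrC ler_wpM2r.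
have -> : b - a - - e * ga = - (a - b - e * gb) + e * (ga - gb) by ring.
rewrite [leRHS]mulrDl (le_trans (ler_normD _ _))// normrN lerD//.
by rewrite normrM ger0_norm// expr2 mulrA mulrC ler_wpM2r.
Qed.

End generator.

(** * Complex power series *)

Section complex_modulus.
Context {R : realType}.
Implicit Types (x y z : R[i]).

Lemma ReD x y : complex.Re (x + y) = complex.Re x + complex.Re y.
Proof. by case: x y => [? ?] [? ?]. Qed.

Lemma ImD x y : complex.Im (x + y) = complex.Im x + complex.Im y.
Proof. by case: x y => [? ?] [? ?]. Qed.

Lemma ReM x y : complex.Re (x * y) =
  complex.Re x * complex.Re y - complex.Im x * complex.Im y.
Proof. by case: x y => [? ?] [? ?]. Qed.

Lemma ImM x y : complex.Im (x * y) =
  complex.Re x * complex.Im y + complex.Im x * complex.Re y.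
Proof. by case: x y => [? ?] [? ?]. Qed.

Lemma ReB x y : complex.Re (x - y) = complex.Re x - complex.Re y.
Proof. by case: x y => [? ?] [? ?]. Qed.

Lemma ImB x y : complex.Im (x - y) = complex.Im x - complex.Im y.
Proof. by case: x y => [? ?] [? ?]. Qed.

Lemma Re_realM (a : R) x : complex.Re (a%:C * x) = a * complex.Re x.
Proof. by rewrite ReM/= mul0r subr0. Qed.

Lemma Im_realM (a : R) x : complex.Im (a%:C * x) = a * complex.Im x.
Proof. by rewrite ImM/= mul0r addr0. Qed.

(** The norm of [R[i]] takes values in [R[i]], which is only partially ordered; [normc] moves the
    estimates to [R]. *)
Lemma normr_normc z : `|z| = (normc z)%:C.
Proof. by []. Qed.

Lemma normc_ge0 z : 0 <= normc z.
Proof. by rewrite -ler0c -normr_normc. Qed.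

Lemma ler_normcD x y : normc (x + y) <= normc x + normc y.
Proof. by have := ler_normD x y; rewrite !normr_normc -rmorphD lecR. Qed.

Lemma normc_opp z : normc (- z) = normc z.
Proof. by have := normrN z; rewrite !normr_normc => /complexI. Qed.

Lemma ler_normcB x y : normc (x - y) <= normc x + normc y.
Proof. by rewrite -(normc_opp y) ler_normcD. Qed.

Lemma normc_distrC x y : normc (x - y) = normc (y - x).
Proof. by rewrite -opprB normc_opp. Qed.

Lemma normcX z n : normc (z ^+ n) = normc z ^+ n.
Proof. by elim: n => [|n IH]; rewrite ?normc1// !exprS normcM IH. Qed.

Lemma normc_real (a : R) : normc a%:C = `|a|.
Proof. by rewrite /normc /= expr0n/= addr0 sqrtr_sqr. Qed.

Lemma normc_nat n : normc (n%:R : R[i]) = n%:R.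
Proof. by rewrite -[n%:R](rmorph_nat (real_complex R)) normc_real normr_nat. Qed.

Lemma normr_Re_le z : `|complex.Re z| <= normc z.
Proof. by rewrite -lecR -normr_normc; exact: normc_ge_Re. Qed.

Lemma normr_Im_le z : `|complex.Im z| <= normc z.
Proof.
case: z => a b /=; rewrite -sqrtr_sqr ler_sqrt ?addr_ge0 ?sqr_ge0//.
by rewrite lerDr sqr_ge0.
Qed.

Lemma normc_le_ReIm z : normc z <= `|complex.Re z| + `|complex.Im z|.
Proof.
rewrite {1}[z]complexE (le_trans (ler_normcD _ _))// normc_real lerD2l normcM.
by rewrite normc_real /normc /= expr0n/= expr1n add0r sqrtr1 mul1r.
Qed.

Lemma cvg_normcP {T : Type} (F : set_system T) {FF : Filter F} (f : T -> R[i]) (l : R[i]) :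
  f @ F --> l <-> forall e : R, 0 < e -> \forall t \near F, normc (l - f t) < e.
Proof.
split=> [/cvgrPdist_lt h e e0|h].
  have e0' : 0 < e%:C by rewrite ltcR.
  by have := h _ e0'; apply: filterS => t; rewrite normr_normc ltcR.
(* Positivity in [R[i]] forces the imaginary part to vanish, so a positive [e] is a real radius. *)
apply/cvgrPdist_lt => e; rewrite ltcE /= => /andP[/eqP ei er].
have -> : e = (complex.Re e)%:C by case: e ei er => a b /= ->.
by have := h _ er; apply: filterS => t; rewrite normr_normc ltcR.
Qed.

Lemma cvg_normc_le (u : nat -> R[i]) (l : R[i]) (K : R) :
  u @ \oo --> l -> (forall n, normc (u n) <= K) -> normc l <= K.
Proof.
move=> /cvg_normcP ul uK; apply/ler_addgt0Pr => e e0.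
have [n _ /(_ n (leqnn n)) h] := ul _ e0.
rewrite -[l](subrK (u n)) (le_trans (ler_normcD _ _))// addrC lerD//.
exact: ltW.
Qed.

Lemma cvgB_seq (u v : nat -> R[i]) (a b : R[i]) :
  u @ \oo --> a -> v @ \oo --> b -> (fun n => u n - v n) @ \oo --> a - b.
Proof. by move=> ua vb; have := cvgB ua vb; apply. Qed.

Lemma cvg_complex (u : nat -> R[i]) (a b : R) :
  (fun n => complex.Re (u n)) @ \oo --> a ->
  (fun n => complex.Im (u n)) @ \oo --> b -> u @ \oo --> a +i* b.
Proof.
move=> /cvgrPdist_lt ua /cvgrPdist_lt ub; apply/cvg_normcP => e e0.
have e2 : 0 < e / 2 by rewrite divr_gt0.
near=> n; rewrite (le_lt_trans (normc_le_ReIm _))// [e]splitr ltrD//.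
  have -> : complex.Re (a +i* b - u n) = a - complex.Re (u n) by case: (u n).
  by near: n; exact: ua.
have -> : complex.Im (a +i* b - u n) = b - complex.Im (u n) by case: (u n).
by near: n; exact: ub.
Unshelve. all: by end_near. Qed.

Lemma real_series_abs_cvg (c : nat -> R) (K : R) :
  (forall n, \sum_(0 <= k < n) `|c k| <= K) -> cvg (series c @ \oo).
Proof.
move=> cK; apply: normed_cvg; apply: nondecreasing_is_cvgn.
  by move=> m n mn; apply: nondecreasing_series => // k _ _; exact: normr_ge0.
by exists K => _ [n _ <-]; exact: cK.
Qed.

Lemma Re_series (c : nat -> R[i]) n :
  complex.Re (series c n) = series (fun k => complex.Re (c k)) n.
Proof.
rewrite /series/=; elim: n => [|n IH]; first by rewrite !big_geq.
by rewrite !big_nat_recr//= -IH; case: (\sum_(_ <= _ < _) _) (c n) => [? ?] [? ?].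
Qed.

Lemma Im_series (c : nat -> R[i]) n :
  complex.Im (series c n) = series (fun k => complex.Im (c k)) n.
Proof.
rewrite /series/=; elim: n => [|n IH]; first by rewrite !big_geq.
by rewrite !big_nat_recr//= -IH; case: (\sum_(_ <= _ < _) _) (c n) => [? ?] [? ?].
Qed.

Lemma complex_series_abs_cvg (c : nat -> R[i]) (K : R) :
  (forall n, \sum_(0 <= k < n) normc (c k) <= K) -> cvg (series c @ \oo).
Proof.
move=> cK.
have Rec : cvg (series (fun n => complex.Re (c n)) @ \oo).
  apply: (@real_series_abs_cvg _ K) => n; apply: le_trans (cK n).
  by apply: ler_sum => k _; exact: normr_Re_le.
have Imc : cvg (series (fun n => complex.Im (c n)) @ \oo).
  apply: (@real_series_abs_cvg _ K) => n; apply: le_trans (cK n).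
  by apply: ler_sum => k _; exact: normr_Im_le.
apply/cvg_ex; eexists; apply: cvg_complex.
  rewrite (_ : (fun n => _) = series (fun n => complex.Re (c n))); first exact: Rec.
  by apply/funext => n; rewrite Re_series.
rewrite (_ : (fun n => _) = series (fun n => complex.Im (c n))); first exact: Imc.
by apply/funext => n; rewrite Im_series.
Qed.

Lemma cvg_series_terms_bounded (c : nat -> R[i]) (l : R[i]) :
  series c @ \oo --> l -> exists M : R, forall n, normc (c n) <= M.
Proof.
move=> cl; have c0 := cvg_series_cvg_0 (cvgP _ cl).
have [M [Mreal cM]] := cvg_seq_bounded (cvgP _ c0).
exists (complex.Re (M + 1)) => n.
have M1 : M < M + 1 by rewrite ltrDl.
have : `|c n| <= M + 1 := cM _ M1 n I.
by rewrite normr_normc lecE /= => /andP[_].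
Qed.

Lemma unit_discE z : unit_disc z = (normc z < 1) :> Prop.
Proof. by rewrite /unit_disc/= normr_normc (_ : 1 = 1%:C)// ltcR. Qed.

End complex_modulus.

Section power_series.
Context {R : realType}.
Implicit Types (a z w : R[i]) (g : R[i] -> R[i]).

(** The full series has sum 6, and the term subtracted in the proof is the exact tail, which makes
    the induction an identity. *)
Lemma sum_sqr_geometric n :
  \sum_(0 <= k < n) k%:R ^+ 2 * (2^-1 : R) ^+ k <= 6.
Proof.
suff -> : \sum_(0 <= k < n) k%:R ^+ 2 * (2^-1 : R) ^+ k =
    6 - (n%:R ^+ 2 + 2 * n%:R + 3) * 2 * 2^-1 ^+ n.
  rewrite lerBlDl lerDr !mulr_ge0 ?addr_ge0 ?exprn_ge0 ?mulr_ge0 ?invr_ge0//.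
elim: n => [|n IH]; first by rewrite big_geq// expr0; ring.
rewrite big_nat_recr//= IH (exprS 2^-1) -[n.+1%:R]natr1.
by move: (n%:R) (2^-1 ^+ n) => m q; field.
Qed.

(* Multiplied by [s ^+ 2] to avoid the exponent [n - 2]. *)
Lemma expr_diff_taylor (s : R) z w n : normc z <= s -> normc w <= s ->
  normc (w ^+ n - z ^+ n - n%:R * z ^+ n.-1 * (w - z)) * s ^+ 2 <=
  n%:R ^+ 2 * s ^+ n * normc (w - z) ^+ 2.
Proof.
move=> zs ws; have s0 : 0 <= s by rewrite (le_trans (normc_ge0 z)).
set e := w - z; elim: n => [|n IH].
  by rewrite !expr0 subrr mul0r mul0r subr0 normc0 mul0r expr0n/= !mul0r.
set D := w ^+ n - _ - _ in IH.
(* The remainder at [n.+1] is [w] times the one at [n] plus one new term, and the constants match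
   since [n ^ 2 + n <= (n + 1) ^ 2]. *)
have -> : w ^+ n.+1 - z ^+ n.+1 - n.+1%:R * z ^+ n.+1.-1 * e =
    w * D + n%:R * z ^+ n.-1 * e ^+ 2.
  have -> : w = z + e by rewrite /e; ring.
  rewrite /D (_ : w = z + e); last by rewrite /e; ring.
  case: n {IH D} => [|n] /=; first by rewrite !expr1 !expr0; ring.
  by rewrite -[n.+2%:R]natr1 !exprS; ring.
rewrite (le_trans (ler_wpM2r (sqr_ge0 s) (ler_normcD _ _)))// mulrDl.
have T1 : normc (w * D) * s ^+ 2 <= n%:R ^+ 2 * s ^+ n.+1 * normc e ^+ 2.
  rewrite normcM -mulrA (le_trans (ler_pM (normc_ge0 w) _ ws IH))//.
    by rewrite mulr_ge0 ?normc_ge0 ?sqr_ge0.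
  by rewrite (exprS s) le_eqVlt; apply/orP; left; apply/eqP; ring.
have T2 : normc (n%:R * z ^+ n.-1 * e ^+ 2) * s ^+ 2 <= n%:R * s ^+ n.+1 * normc e ^+ 2.
  rewrite !normcM !normcX normc_nat; case: n {IH D T1} => [|n] /=; first by rewrite !mul0r.
  have -> : n.+1%:R * s ^+ n.+2 * normc e ^+ 2 = n.+1%:R * s ^+ n * normc e ^+ 2 * s ^+ 2.
    by rewrite !exprS; ring.
  rewrite !ler_wpM2r ?sqr_ge0// ler_wpM2l//.
  by rewrite lerXn2r ?nnegrE// normc_ge0.
apply: le_trans (lerD T1 T2) _; rewrite -!mulrDl !ler_wpM2r ?sqr_ge0 ?exprn_ge0//.
by rewrite -!natrX -natrD ler_nat; lia.
Qed.

Definition deriv_coefs (b : nat -> R[i]) n : R[i] := n.+1%:R * b n.+1.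

(** Sums the bound for monomials. Both [z] and [w] range over the ball: a base point that can move
    is what the compactness argument on the circle requires. *)
Lemma power_series_taylor (b : nat -> R[i]) a g (e : R) : 0 < e ->
  (forall z, normc (z - a) < e -> series (fun n => b n * (z - a) ^+ n) @ \oo --> g z) ->
  exists (g' : R[i] -> R[i]) (K r : R), [/\ 0 < r, 0 <= K,
    forall z, normc (z - a) < r ->
      series (fun n => deriv_coefs b n * (z - a) ^+ n) @ \oo --> g' z &
    forall z w, normc (z - a) < r -> normc (w - a) < r ->
      normc (g w - g z - (w - z) * g' z) <= K * normc (w - z) ^+ 2].
Proof.
(* Terms are bounded at distance [2 * s = e / 2] from [a], inside the ball of convergence; at
   distance [s] they are then dominated by a geometric sequence of ratio 1/2. *)
move=> e0 gE; pose s := e / 4; have s0 : 0 < s by rewrite divr_gt0.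
have [M bM] : exists M : R, forall n, normc (b n) * (2 * s) ^+ n <= M.
  have h : normc (a + (2 * s)%:C - a) < e.
    by rewrite addrC addKr normc_real ger0_norm /s; lra.
  have [M hM] := cvg_series_terms_bounded (gE _ h).
  exists M => n; have := hM n; rewrite addrC addKr normcM normcX normc_real.
  by rewrite ger0_norm// mulr_ge0// ltW.
have M0 : 0 <= M by rewrite (le_trans _ (bM 0%N))// expr0 mulr1 normc_ge0.
have bs n : normc (b n) * s ^+ n <= M * 2^-1 ^+ n.
  by rewrite exprVn ler_pdivlMr ?exprn_gt0// -mulrA -exprMn (mulrC s).
(* A deliberate loss, so that the derived series is controlled by the same sum as the Taylor
   remainders. *)
have sE n : n%:R * (2^-1 : R) ^+ n <= n%:R ^+ 2 * 2^-1 ^+ n.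
  by rewrite ler_wpM2r ?exprn_ge0 ?invr_ge0// -natrX ler_nat; nia.
have dcvg u : normc u <= s -> cvg (series (fun n => deriv_coefs b n * u ^+ n) @ \oo).
  move=> us; apply: (@complex_series_abs_cvg _ _ (M * 6 / s)) => n.
  rewrite ler_pdivlMr// mulr_suml.
  apply: (@le_trans _ _ (M * \sum_(0 <= k < n.+1) k%:R ^+ 2 * (2^-1 : R) ^+ k)); last first.
    by rewrite ler_wpM2l// sum_sqr_geometric.
  rewrite big_nat_recl//= expr0n/= mul0r add0r mulr_sumr; apply: ler_sum => k _.
  rewrite /deriv_coefs !normcM normc_nat normcX.
  apply: (@le_trans _ _ (M * (k.+1%:R * 2^-1 ^+ k.+1))); last by rewrite ler_wpM2l.
  rewrite [leRHS]mulrCA -!mulrA ler_wpM2l//; apply: le_trans (bs k.+1).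
  rewrite ler_wpM2l ?normc_ge0// exprSr ler_wpM2r ?(ltW s0)//.
  by rewrite lerXn2r ?nnegrE ?normc_ge0// ltW.
pose g' z := lim (series (fun n => deriv_coefs b n * (z - a) ^+ n) @ \oo).
have g'E z : normc (z - a) < s ->
    series (fun n => deriv_coefs b n * (z - a) ^+ n) @ \oo --> g' z.
  by move=> /ltW /dcvg.
exists g', (6 * M / s ^+ 2), s; split => //.
  by apply: divr_ge0; [exact: mulr_ge0|exact: sqr_ge0].
move=> z w zs ws.
have zC := gE _ (lt_le_trans zs (_ : s <= e)); have wC := gE _ (lt_le_trans ws (_ : s <= e)).
have se : s <= e by rewrite /s; lra.
move: {zC}(zC se) {wC}(wC se) => zC wC.
rewrite mulrAC ler_pdivlMr ?exprn_gt0// .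
rewrite -[s ^+ 2]ger0_norm ?sqr_ge0// -normc_real -normcM.
set A := fun k => b k * ((w - a) ^+ k - (z - a) ^+ k -
  k%:R * (z - a) ^+ k.-1 * (w - z)).
have Acvg : (fun n => series A n.+1 * (s ^+ 2)%:C) @ \oo -->
    (g w - g z - (w - z) * g' z) * (s ^+ 2)%:C.
  apply: cvgM; last exact: cvg_cst.
  (* The derivative part of the term of index 0 vanishes, so [n.+1] terms of [g] go with [n] terms
     of the derived series. *)
  have -> : (fun n => series A n.+1) = (fun n =>
    series (fun k => b k * (w - a) ^+ k) n.+1 -
    series (fun k => b k * (z - a) ^+ k) n.+1 -
    (w - z) * series (fun k => deriv_coefs b k * (z - a) ^+ k) n).
    apply/funext => n; rewrite /series/= /A.
    under eq_bigr do rewrite mulrBr (mulrBr (b _) (_ ^+ _)).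
    rewrite !sumrB; congr (_ - _); rewrite big_nat_recl//= mul0r mul0r mulr0 add0r.
    rewrite mulr_sumr; apply: eq_bigr => k _; rewrite /deriv_coefs; ring.
  have shift (u l : R[i]) : series (fun k => b k * u ^+ k) @ \oo --> l ->
      (fun n => series (fun k => b k * u ^+ k) n.+1) @ \oo --> l.
    by move=> h; rewrite (cvg_shiftS (series (fun k => b k * u ^+ k))).
  have dC : (fun n => (w - z) * series (fun k => deriv_coefs b k * (z - a) ^+ k) n)
      @ \oo --> (w - z) * g' z by apply: cvgM; [exact: cvg_cst|exact: g'E].
  by apply: cvgB_seq dC; apply: cvgB_seq; exact: shift.
apply: cvg_normc_le Acvg _ => n; rewrite normcM normc_real ger0_norm ?sqr_ge0//.
rewrite /series/=.
apply: (@le_trans _ _ (\sum_(0 <= k < n.+1) normc (A k) * s ^+ 2)).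
  rewrite -mulr_suml ler_wpM2r ?sqr_ge0//.
  elim/big_ind2 : _ => [|x1 x2 y1 y2 h1 h2|//]; first by rewrite normc0.
  by rewrite (le_trans (ler_normcD _ _))// lerD.
apply: (@le_trans _ _ (\sum_(0 <= k < n.+1) M * normc (w - z) ^+ 2 * (k%:R ^+ 2 * 2^-1 ^+ k))).
  apply: ler_sum => k _; rewrite /A normcM -mulrA.
  have -> : w - z = (w - a) - (z - a) by ring.
  apply: le_trans (ler_wpM2l (normc_ge0 _) (expr_diff_taylor k (ltW zs) (ltW ws))) _.
  set N2 := normc _ ^+ 2.
  have -> : normc (b k) * (k%:R ^+ 2 * s ^+ k * N2) = normc (b k) * s ^+ k * (k%:R ^+ 2 * N2) by ring.
  have -> : M * N2 * (k%:R ^+ 2 * 2^-1 ^+ k) = M * 2^-1 ^+ k * (k%:R ^+ 2 * N2) by ring.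
  by rewrite ler_wpM2r// mulr_ge0 ?sqr_ge0.
rewrite -mulr_sumr.
have -> : 6 * M * normc (w - z) ^+ 2 = M * normc (w - z) ^+ 2 * 6 by ring.
by apply: ler_wpM2l; [exact/mulr_ge0/sqr_ge0|exact: sum_sqr_geometric].
Qed.

End power_series.

(** * Complex derivatives of analytic functions, and closure properties *)

Section complex_derivative.
Context {R : realType}.
Implicit Types (a z w h : R[i]) (g : R[i] -> R[i]) (D : set R[i]).

(** No sign is asked of [K]; proofs that need one pass to its absolute value. *)
Definition cderiv_est g z (l : R[i]) := exists K r : R, 0 < r /\
  forall h, normc h < r -> normc (g (z + h) - g z - h * l) <= K * normc h ^+ 2.

Lemma cderiv_est_quotient g z (l : R[i]) : cderiv_est g z l ->
  (fun h => h^-1 * (g (z + h) - g z)) @ 0^' --> l.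
Proof.
move=> [K [r [r0 gK]]]; apply/cvg_normcP => e e0.
pose s := Num.min r (e / (`|K| + 1)).
have K1 : 0 < `|K| + 1 by rewrite ltr_wpDl.
have s0 : 0 < s by rewrite lt_min r0 divr_gt0.
have s0' : 0 < s%:C by rewrite ltcR.
near=> h.
have hs : normc h < s.
  by rewrite -ltcR -normr_normc; near: h; exact: dnbhs0_lt.
have hn0 : h != 0 by near: h; exact: nbhs_dnbhs_neq.
have h0 : 0 < normc h by rewrite -ltcR -normr_normc normr_gt0.
have -> : l - h^-1 * (g (z + h) - g z) = - (h^-1 * (g (z + h) - g z - h * l)).
  by rewrite [in RHS]mulrBr mulKf// opprB.
rewrite normc_opp normcM normcV ltr_pdivrMl//.
have hr : normc h < r by rewrite (lt_le_trans hs)// ge_min lexx.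
apply: le_lt_trans (gK _ hr) _.
rewrite expr2 mulrA mulrC ltr_pM2l//.
apply: (@le_lt_trans _ _ (`|K| * normc h)).
  by rewrite ler_wpM2r ?normc_ge0// ler_norm.
have : normc h < e / (`|K| + 1) by rewrite (lt_le_trans hs)// ge_min lexx orbT.
by rewrite ltr_pdivlMr//; apply: le_lt_trans; rewrite mulrC ler_wpM2l ?normc_ge0// lerDl.
Unshelve. all: by end_near. Qed.

Lemma cderiv_est_derive1 g z (l : R[i]) : cderiv_est g z l ->
  derivable g z 1 /\ derive1 g z = l.
Proof.
move=> /cderiv_est_quotient gl.
have E1 : (fun h => h^-1 *: ((g \o shift z) (h *: 1) - g z)) =
    (fun h => h^-1 * (g (z + h) - g z)).
  by apply/funext => h /=; rewrite -[h *: 1]/(h * 1) mulr1 (addrC h).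
have E2 : (fun h => h^-1 *: (g (h + z) - g z)) =
    (fun h => h^-1 * (g (z + h) - g z)).
  by apply/funext => h /=; rewrite (addrC h).
split; first by rewrite /derivable E1; apply/cvg_ex; exists l.
by rewrite /derive1 E2; exact: norm_cvg_lim.
Qed.

Lemma analytic_local_taylor D g a : analytic_on D g -> D a ->
  exists (b : nat -> R[i]) (K r : R), [/\ 0 < r, 0 <= K,
    forall z, normc (z - a) < r ->
      series (fun n => b n * (z - a) ^+ n) @ \oo --> derive1 g z &
    forall z w, normc (z - a) < r -> normc (w - a) < r ->
      normc (g w - g z - (w - z) * derive1 g z) <= K * normc (w - z) ^+ 2].
Proof.
move=> gD Da; have [b [e [e0 gE]]] := gD a Da.
have [z za|g' [K [r [r0 K0 g'E gK]]]] := power_series_taylor e0 (b := b) (a := a) (g := g).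
  by apply: gE; rewrite normr_normc ltcR.
(* The ball of radius [r - normc (z - a)] about [z] stays in the ball about [a], so the estimate
   identifies [derive1 g] with the sum of the derived series there. *)
have dg z : normc (z - a) < r -> derive1 g z = g' z.
  move=> zr; apply: (cderiv_est_derive1 _).2; exists K, (r - normc (z - a)).
  split; first by rewrite subr_gt0.
  move=> h hr; have := gK z (z + h) zr; rewrite (addrC z h) addrK; apply.
  by rewrite -addrA (le_lt_trans (ler_normcD _ _))// -ltrBrDr.
exists (deriv_coefs b), K, r; split; [exact: r0|exact: K0| |].
  by move=> z zr; rewrite (dg _ zr); exact: g'E.
by move=> z w zr wr; rewrite (dg _ zr); exact: gK.
Qed.

Lemma analytic_cderiv_est D g z : analytic_on D g -> D z ->
  cderiv_est g z (derive1 g z).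
Proof.
move=> gD Dz; have [b [K [r [r0 K0 _ gK]]]] := analytic_local_taylor gD Dz.
exists K, r; split => // h hr; have := gK z (z + h).
by rewrite (addrC z h) addrK subrr normc0; apply.
Qed.

Lemma analytic_derive1 D g : analytic_on D g -> analytic_on D (derive1 g).
Proof.
move=> gD a Da; have [b [K [r [r0 K0 gE _]]]] := analytic_local_taylor gD Da.
exists b, r; split; first exact: r0.
by move=> z; rewrite normr_normc ltcR; exact: gE.
Qed.

Lemma analyticD D g1 g2 : analytic_on D g1 -> analytic_on D g2 ->
  analytic_on D (fun z => g1 z + g2 z).
Proof.
move=> g1D g2D a Da; have [b1 [e1 [e10 g1E]]] := g1D a Da.
have [b2 [e2 [e20 g2E]]] := g2D a Da.
exists (fun n => b1 n + b2 n), (Num.min e1 e2); split; first by rewrite lt_min e10.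
move=> z; rewrite normr_normc ltcR lt_min => /andP[z1 z2].
have -> : series (fun n => (b1 n + b2 n) * (z - a) ^+ n) =
    (fun n => series (fun n => b1 n * (z - a) ^+ n) n +
              series (fun n => b2 n * (z - a) ^+ n) n).
  by apply/funext => n; rewrite /series/= -big_split; apply: eq_bigr => k _; rewrite mulrDl.
have h1 : series (fun n => b1 n * (z - a) ^+ n) @ \oo --> g1 z.
  by apply: g1E; rewrite normr_normc ltcR.
have h2 : series (fun n => b2 n * (z - a) ^+ n) @ \oo --> g2 z.
  by apply: g2E; rewrite normr_normc ltcR.
by have := cvgD h1 h2; apply.
Qed.

Lemma analyticZ D (k : R[i]) g : analytic_on D g ->
  analytic_on D (fun z => k * g z).
Proof.
move=> gD a Da; have [b [e [e0 gE]]] := gD a Da.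
exists (fun n => k * b n), e; split; first exact: e0.
move=> z za.
have -> : series (fun n => k * b n * (z - a) ^+ n) =
    (fun n => k * series (fun n => b n * (z - a) ^+ n) n).
  by apply/funext => n; rewrite /series/= mulr_sumr; apply: eq_bigr => ? _; rewrite mulrA.
by have := cvgM (cvg_cst k) (gE z za); apply.
Qed.

Lemma analytic_mul_id D g : analytic_on D g -> analytic_on D (fun z => z * g z).
Proof.
move=> gD a Da; have [b [e [e0 gE]]] := gD a Da.
(* From [z = a + (z - a)]: the second summand raises degrees by one, hence the shifted coefficient
   and the 0 at degree 0. *)
exists (fun n => a * b n + (if n is m.+1 then b m else 0)), e; split; first exact: e0.
move=> z za.
set S := series (fun n => b n * (z - a) ^+ n).
set S' := series _.
have SE n : S' n.+1 = a * S n.+1 + (z - a) * S n.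
  rewrite /S' /S /series/=; elim: n => [|n IH].
    by rewrite !big_nat_recr//= !big_geq//= !expr0; ring.
  rewrite big_nat_recr//= IH [in RHS]big_nat_recr//= [in X in _ = _ + _ * X]big_nat_recr//=.
  by rewrite !exprS; ring.
suff : (fun n => S' n.+1) @ \oo --> z * g z by rewrite (cvg_shiftS S').
have -> : (fun n => S' n.+1) = (fun n => a * S n.+1 + (z - a) * S n).
  by apply/funext => n; rewrite SE.
have -> : z * g z = a * g z + (z - a) * g z by ring.
have h1 : (fun n => a * S n.+1) @ \oo --> a * g z.
  apply: cvgM; first exact: cvg_cst.
  by rewrite (cvg_shiftS S); exact: gE.
have h2 : (fun n => (z - a) * S n) @ \oo --> (z - a) * g z.
  by apply: cvgM; [exact: cvg_cst|exact: gE].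
by have := cvgD h1 h2; apply.
Qed.

End complex_derivative.

(** * Analytic functions along a circle *)

Section unit_circle.
Context {R : realType}.
Implicit Types (x y : R) (z h : R[i]) (g : R[i] -> R[i]).

Lemma expiD x y : expi (x + y) = expi x * expi y.
Proof.
by rewrite /expi cosD sinD (addrC (sin x * cos y)).
Qed.

Lemma normc_expi x : normc (expi x) = 1.
Proof. by rewrite /normc /= cos2Dsin2 sqrtr1. Qed.

(** The intermediate point is kept no larger than [y] in absolute value, so that [cos c - 1] can
    later be bounded in terms of [y]. *)
Lemma sin_mean_value y : exists2 c : R, `|c| <= `|y| & sin y = cos c * y.
Proof.
have dsin (u : R) : is_derive u 1 sin (cos u) by exact: is_derive_sin.
have csin (A : set R) : {within A, continuous (sin : R -> R)}.
  by apply: continuous_subspaceT => u; exact: continuous_sin.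
have [y0|/ltW y0] := leP 0 y.
  have [c] := MVT_segment y0 (fun u _ => dsin u) (csin _).
  rewrite in_itv/= => /andP[c0 cy]; rewrite sin0 !subr0 => ->.
  by exists c => //; rewrite !ger0_norm.
have [c] := MVT_segment y0 (fun u _ => dsin u) (csin _).
rewrite in_itv/= => /andP[yc c0]; rewrite sin0 !sub0r mulrN => /oppr_inj ->.
by exists c => //; rewrite !ler0_norm// lerN2.
Qed.

Lemma ler_norm_sin y : `|sin y| <= `|y|.
Proof.
have [c _ ->] := sin_mean_value y.
by rewrite normrM ler_piMl// cos_max.
Qed.

Lemma ler_norm_cosB1 y : `|cos y - 1| <= y ^+ 2.
Proof.
have -> : cos y - 1 = - 2 * sin (y / 2) ^+ 2.
  by rewrite {1}[y]splitr cosD -!expr2 cos2sin2; ring.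
rewrite normrM normrX normrN (ger0_norm (ler0n _ 2)).
have := ler_norm_sin (y / 2); rewrite normrM (@ger0_norm _ 2^-1)//.
rewrite -[y ^+ 2]real_normK ?num_real//.
move: (normr_ge0 (sin (y / 2))) (normr_ge0 y); nra.
Qed.

(** The constant is 1 for the sine plus 2 for the cosine, where [y ^+ 2] serves for [|y| <= 1] and
    the trivial bound 2 otherwise. *)
Lemma expi_lipschitz y : normc (expi y - 1) <= 3 * `|y|.
Proof.
rewrite (le_trans (normc_le_ReIm _))//= subr0.
have h1 := ler_norm_sin y; have h2 := ler_norm_cosB1 y.
have h3 : `|cos y - 1| <= 2.
  by rewrite (le_trans (ler_normB _ _))// normr1 (_ : 2 = 1 + 1)// lerD2r cos_max.
have y0 := normr_ge0 y; move: h2; rewrite -[y ^+ 2]real_normK ?num_real// => h2.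
have [y1|y1] := leP `|y| 1; nra.
Qed.

(** For the imaginary part, [sin y - y = (cos c - 1) * y] is cubic for small [y] and at most
    [2 * |y|] always. *)
Lemma expi_taylor y : normc (expi y - 1 - y *i) <= 3 * y ^+ 2.
Proof.
rewrite (le_trans (normc_le_ReIm _))//= !subr0.
have h2 := ler_norm_cosB1 y.
suff : `|sin y - y| <= 2 * y ^+ 2 by lra.
have [c cy ->] := sin_mean_value y.
have -> : cos c * y - y = (cos c - 1) * y by ring.
have h3 := ler_norm_cosB1 c.
have h4 : `|cos c - 1| <= 2.
  by rewrite (le_trans (ler_normB _ _))// normr1 (_ : 2 = 1 + 1)// lerD2r cos_max.
rewrite normrM -[y ^+ 2]real_normK ?num_real//.
move: h3; rewrite -[c ^+ 2]real_normK ?num_real// => h3.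
have y0 := normr_ge0 y; have c0 := normr_ge0 c.
have [y1|y1] := leP `|y| 1; last by nra.
have : `|c| ^+ 2 <= `|y| by nra.
nra.
Qed.

(** Lets the compactness of [[- pi, pi]] control all real angles. *)
Lemma expi_angle x : exists2 y : R, - pi <= y <= pi & expi x = expi y.
Proof.
have c1 : -1 <= cos x <= 1 by rewrite cos_geN1 cos_le1.
have a0 := acos_ge0 c1; have api := acos_lepi c1; have ck := acosK c1.
have sa : sin (acos (cos x)) = `|sin x|.
  by rewrite sin_acos// -sin2cos2 sqrtr_sqr.
have [s0|/ltW s0] := leP 0 (sin x).
  exists (acos (cos x)); first by rewrite api andbT (le_trans _ a0)// oppr_le0 pi_ge0.
  by rewrite /expi ck sa ger0_norm.
exists (- acos (cos x)); first by rewrite lerN2 api/= (le_trans _ (pi_ge0 _))// oppr_le0.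
by rewrite /expi cosN sinN ck sa ler0_norm// opprK.
Qed.

Lemma analytic_circle_taylor g z : analytic_on unit_disc g -> normc z < 1 ->
  exists K r : R, [/\ 0 < r, 0 <= K, forall x, normc (g (z * expi x)) <= K &
    forall x h, normc h < r ->
      normc (g (z * expi x + h) - g (z * expi x) - h * derive1 g (z * expi x))
        <= K * normc h ^+ 2].
Proof.
move=> gD z1.
(* One integer encodes all constants: bounds by [n] and radius [1 / (n + 1)]. The property holds
   eventually near each angle, and [near_covering] then provides a single [n] for the interval. *)
pose Q (n : nat) (x : R) := normc (g (z * expi x)) <= n%:R /\
  forall h, normc h < n.+1%:R^-1 ->
   normc (g (z * expi x + h) - g (z * expi x) - h * derive1 g (z * expi x))
        <= n%:R * normc h ^+ 2.
have cpt : near_covering (`[- pi, pi]%classic : set R).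
  by apply/compact_near_coveringP; exact: segment_compact.
have [] := cpt nat \oo Q _.
  move=> x0 _; set a := z * expi x0.
  have Da : unit_disc a by rewrite unit_discE normcM normc_expi mulr1.
  have [b [K [r [r0 K0 _ gK]]]] := analytic_local_taylor gD Da.
  pose M := normc (g a) + K * r ^+ 2 + r * normc (derive1 g a).
  near=> x n => /=.
  (* Staying within [r / 2] of [a] leaves room for an increment [h] of the same size. *)
  have xr : normc (z * expi x - a) < r / 2.
    have -> : z * expi x - a = z * expi x0 * (expi (x - x0) - 1).
      by rewrite /a mulrBr mulr1 -mulrA -expiD (addrC x0) subrK.
    rewrite !normcM normc_expi mulr1.
    apply: (@le_lt_trans _ _ (1 * (3 * `|x - x0|))).
      by rewrite ler_pM ?normc_ge0 ?expi_lipschitz// ltW.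
    rewrite mul1r -ltr_pdivlMl// distrC; near: x.
    by apply: (@cvgr_dist_lt _ _ _ (nbhs x0) _ id x0) => //; rewrite mulr_gt0// divr_gt0.
  have nM : M <= n%:R by near: n; exact: nbhs_infty_ger.
  have nK : K <= n%:R by near: n; exact: nbhs_infty_ger.
  have xr' : normc (z * expi x - a) < r by rewrite (lt_trans xr)// ltr_pdivrMr// ltr_pMr// ltr1n.
  split.
    have := gK a (z * expi x); rewrite subrr normc0 => /(_ r0 xr').
    set e := z * expi x - a in xr' * => H.
    have -> : g (z * expi x) = (g (z * expi x) - g a - e * derive1 g a) + (g a + e * derive1 g a).
      by ring.
    apply: le_trans nM; rewrite (le_trans (ler_normcD _ _))//.
    rewrite /M -[leRHS]addrA [leRHS]addrCA lerD//.
      by rewrite (le_trans H)// ler_wpM2l// lerXn2r ?nnegrE ?normc_ge0// ltW.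
    rewrite (le_trans (ler_normcD _ _))// lerD// normcM ler_wpM2r ?normc_ge0//.
    exact: ltW.
  move=> h hn; have := gK (z * expi x) (z * expi x + h) xr'.
  rewrite (addrC _ h) addrK => H; apply: le_trans (H _) _.
    rewrite -addrA (le_lt_trans (ler_normcD _ _))// [r]splitr ltrD//.
    rewrite (lt_le_trans hn)// invf_ple ?posrE ?divr_gt0// (@le_trans _ _ n%:R) ?ler_nat//.
    by near: n; exact: nbhs_infty_ger.
  by rewrite ler_wpM2r ?sqr_ge0.
move=> n _ /(_ n (leqnn n)) HQ; exists n%:R, n.+1%:R^-1; split => // [x|x h].
  by have [y ypi ->] := expi_angle x; apply: (HQ y _).1; rewrite /= in_itv.
by have [y ypi ->] := expi_angle x; apply: (HQ y _).2; rewrite /= in_itv.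
Unshelve. all: by end_near. Qed.

(** Chain rule along the circle, made global in [y]. Small [y] use the local Taylor bound; once
    [3 * |y| >= r], boundedness suffices, because [1 <= (3 / r * |y|) ^+ 2]. *)
Lemma analytic_curve_taylor g z : analytic_on unit_disc g -> normc z < 1 ->
  exists K : R, forall x y,
    normc (g (z * expi (x + y)) - g (z * expi x) -
      y *i * (z * expi x * derive1 g (z * expi x))) <= K * y ^+ 2.
Proof.
move=> gD z1; have [K [r [r0 K0 gK gT]]] := analytic_circle_taylor gD z1.
have [L [_ [_ L0 dgL _]]] := analytic_circle_taylor (analytic_derive1 gD) z1.
have z1' := ltW z1.
(* [9 * K] carries the square of the Lipschitz constant 3, [3 * L] comes from [expi_taylor], and the
   last term from large [y]. *)
exists (9 * K + 3 * L + (2 * K + r * L) * (3 / r) ^+ 2) => x y.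
set a := z * expi x; have a1 : normc a <= 1 by rewrite normcM normc_expi mulr1.
have y2 : y ^+ 2 = `|y| ^+ 2 by rewrite real_normK ?num_real.
have [yr|yr] := ltP (3 * `|y|) r.
  pose h := a * (expi y - 1).
  have -> : z * expi (x + y) = a + h by rewrite /h /a expiD; ring.
  have hy : normc h <= 3 * `|y|.
    by rewrite normcM -[leRHS]mul1r ler_pM ?normc_ge0// expi_lipschitz.
  have -> : g (a + h) - g a - y *i * (a * derive1 g a) =
    (g (a + h) - g a - h * derive1 g a) + a * (expi y - 1 - y *i) * derive1 g a.
    by rewrite /h; ring.
  have T1 := gT x h (le_lt_trans hy yr).
  have T2 : normc h ^+ 2 <= 9 * y ^+ 2.
    rewrite y2 (_ : 9 = 3 ^+ 2); last by ring.
    by rewrite -exprMn lerXn2r ?nnegrE ?normc_ge0// mulr_ge0.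
  have T3 : normc (a * (expi y - 1 - y *i) * derive1 g a) <= 3 * y ^+ 2 * L.
    rewrite normcM ler_pM ?normc_ge0//; last exact: dgL.
    by rewrite normcM -[leRHS]mul1r ler_pM ?normc_ge0// expi_taylor.
  rewrite (le_trans (ler_normcD _ _))// (le_trans (lerD T1 T3))//.
  have T4 : K * normc h ^+ 2 <= K * (9 * y ^+ 2) by rewrite ler_wpM2l.
  have T5 : 0 <= (2 * K + r * L) * (3 / r) ^+ 2 * y ^+ 2.
    by rewrite mulr_ge0 ?sqr_ge0// mulr_ge0 ?sqr_ge0// addr_ge0// mulr_ge0// ltW.
  by lra.
have T1 : normc (g (z * expi (x + y)) - g a) <= 2 * K.
  by rewrite (le_trans (ler_normcB _ _))// [leRHS]mulr_natl mulr2n lerD//; exact: gK.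
have T2 : normc (y *i * (a * derive1 g a)) <= `|y| * L.
  rewrite normcM ler_pM ?normc_ge0//.
    by rewrite /normc /= expr0n/= add0r sqrtr_sqr.
  rewrite normcM -[leRHS]mul1r ler_pM ?normc_ge0//; exact: dgL.
rewrite (le_trans (ler_normcB _ _))// (le_trans (lerD T1 T2))//.
have q1 : 1 <= 3 / r * `|y| by rewrite mulrAC ler_pdivlMr// mul1r.
have ry : `|y| <= r * (3 / r * `|y|) ^+ 2.
  have -> : r * (3 / r * `|y|) ^+ 2 = (3 * `|y|) * (3 / r * `|y|).
    by field; rewrite gt_eqF.
  by have := normr_ge0 y; nra.
have T3 : 2 * K <= 2 * K * (3 / r * `|y|) ^+ 2.
  by rewrite ler_peMr ?mulr_ge0// exprn_ege1.
have T4 : `|y| * L <= r * (3 / r * `|y|) ^+ 2 * L by rewrite ler_wpM2r.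
have T5 : 0 <= (9 * K + 3 * L) * y ^+ 2 by rewrite mulr_ge0 ?sqr_ge0// addr_ge0// mulr_ge0.
apply: le_trans (lerD T3 T4) _; rewrite [leRHS]mulrDl.
move: T5; rewrite y2; set q := (3 / r * `|y|) ^+ 2.
have -> : (2 * K + r * L) * (3 / r) ^+ 2 * `|y| ^+ 2 = 2 * K * q + r * q * L.
  by rewrite /q; ring.
by lra.
Qed.

End unit_circle.

(** * Complex expectations and derivatives *)

Section complex_expectation.
Context {R : realType} {d : measure_display} {T : measurableType d}.
Variable P : probability T R.
Implicit Types (Y Z : T -> R[i]).

Definition bounded_crv Y :=
  bounded_rv (fun w => complex.Re (Y w)) /\ bounded_rv (fun w => complex.Im (Y w)).

Lemma bounded_crv_cst (a : R[i]) : bounded_crv (fun=> a).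
Proof. by split; exact: bounded_rv_cst. Qed.

Lemma bounded_crvD Y Z : bounded_crv Y -> bounded_crv Z ->
  bounded_crv (fun w => Y w + Z w).
Proof.
move=> [rY iY] [rZ iZ]; split; first by under eq_fun do rewrite ReD; exact: bounded_rvD.
by under eq_fun do rewrite ImD; exact: bounded_rvD.
Qed.

Lemma bounded_crvM Y Z : bounded_crv Y -> bounded_crv Z ->
  bounded_crv (fun w => Y w * Z w).
Proof.
move=> [rY iY] [rZ iZ]; split.
  by under eq_fun do rewrite ReM; apply: bounded_rvB; exact: bounded_rvM.
by under eq_fun do rewrite ImM; apply: bounded_rvD; exact: bounded_rvM.
Qed.

Lemma bounded_crvX Y k : bounded_crv Y -> bounded_crv (fun w => Y w ^+ k).
Proof.
move=> bY; elim: k => [|k IH]; first exact: bounded_crv_cst.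
by under eq_fun do rewrite exprS; exact: bounded_crvM.
Qed.

Lemma bounded_crvZ (a : R[i]) Y : bounded_crv Y -> bounded_crv (fun w => a * Y w).
Proof. by move=> bY; apply: bounded_crvM => //; exact: bounded_crv_cst. Qed.

Lemma bounded_crvB Y Z : bounded_crv Y -> bounded_crv Z ->
  bounded_crv (fun w => Y w - Z w).
Proof.
move=> bY /(bounded_crvZ (-1)) bZ; under eq_fun do rewrite -mulN1r.
exact: bounded_crvD.
Qed.

Lemma cexpectationE Y : cexpectation P Y =
  Rintegral P setT (fun w => complex.Re (Y w)) +i*
  Rintegral P setT (fun w => complex.Im (Y w)).
Proof. by rewrite /cexpectation unlock. Qed.

Lemma cexpectationD Y Z : bounded_crv Y -> bounded_crv Z ->
  cexpectation P (fun w => Y w + Z w) = cexpectation P Y + cexpectation P Z.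
Proof.
move=> [rY iY] [rZ iZ]; rewrite !cexpectationE.
under eq_Rintegral do rewrite ReD; under [X in _ +i* X = _]eq_Rintegral do rewrite ImD.
by rewrite !RexpectationD.
Qed.

Lemma cexpectationZ (a : R[i]) Y : bounded_crv Y ->
  cexpectation P (fun w => a * Y w) = a * cexpectation P Y.
Proof.
move=> [rY iY]; rewrite !cexpectationE.
under eq_Rintegral do rewrite ReM; under [X in _ +i* X = _]eq_Rintegral do rewrite ImM.
rewrite RexpectationB ?RexpectationD ?RexpectationZ//; try exact: bounded_rvZ.
by case: a.
Qed.

Lemma cexpectationB Y Z : bounded_crv Y -> bounded_crv Z ->
  cexpectation P (fun w => Y w - Z w) = cexpectation P Y - cexpectation P Z.
Proof.
move=> bY bZ; under [in LHS]eq_fun do rewrite -mulN1r.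
by rewrite cexpectationD ?cexpectationZ ?mulN1r//; exact: bounded_crvZ.
Qed.

(** The factor 2 comes from treating real and imaginary parts separately; it is harmless, as only
    the order of remainders matters. *)
Lemma normc_cexpectation_le Y (K : R) : bounded_crv Y ->
  (forall w, normc (Y w) <= K) -> normc (cexpectation P Y) <= 2 * K.
Proof.
move=> [rY iY] YK; rewrite cexpectationE (le_trans (normc_le_ReIm _))//=.
rewrite mulr_natl mulr2n -(Rexpectation_cst P K) lerD//; apply: normr_Rexpectation => //.
- exact: bounded_rv_cst.
- by move=> w; rewrite (le_trans (normr_Re_le _)).
- exact: bounded_rv_cst.
- by move=> w; rewrite (le_trans (normr_Im_le _)).
Qed.

End complex_expectation.

(** * Calculus of quadratic estimates, in the complex and in the real variable *)

Section derivative_estimates.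
Context {R : realType}.
Implicit Types (D : set R) (x y : R) (z l h : R[i]).

Lemma cderiv_estD (f g : R[i] -> R[i]) z k l :
  cderiv_est f z k -> cderiv_est g z l ->
  cderiv_est (fun w => f w + g w) z (k + l).
Proof.
move=> [K [r [r0 fK]]] [L [s [s0 gL]]]; exists (K + L), (Num.min r s).
split=> [|h]; first by rewrite lt_min r0.
rewrite lt_min => /andP[hr hs].
have -> : f (z + h) + g (z + h) - (f z + g z) - h * (k + l) =
  (f (z + h) - f z - h * k) + (g (z + h) - g z - h * l) by ring.
by rewrite (le_trans (ler_normcD _ _))// mulrDl lerD ?fK ?gL.
Qed.

Lemma cderiv_estZ (a : R[i]) (f : R[i] -> R[i]) z l :
  cderiv_est f z l -> cderiv_est (fun w => a * f w) z (a * l).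
Proof.
move=> [K [r [r0 fK]]]; exists (normc a * K), r; split=> // h hr.
have -> : a * f (z + h) - a * f z - h * (a * l) = a * (f (z + h) - f z - h * l).
  by ring.
by rewrite normcM -mulrA ler_wpM2l ?normc_ge0 ?fK.
Qed.

Lemma cderiv_est_mul_id (f : R[i] -> R[i]) z l :
  cderiv_est f z l -> cderiv_est (fun w => w * f w) z (f z + z * l).
Proof.
move=> [K [r [r0 fK]]]; exists (normc z * K + (`|K| * r + normc l)), r.
split=> // h hr; set e := f (z + h) - f z - h * l.
have -> : (z + h) * f (z + h) - z * f z - h * (f z + z * l) =
  z * e + h * (e + h * l) by rewrite /e; ring.
have eK : normc e <= K * normc h ^+ 2 by exact: fK.
rewrite (le_trans (ler_normcD _ _))// mulrDl lerD//.
  by rewrite normcM -mulrA ler_wpM2l ?normc_ge0.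
rewrite normcM expr2 mulrA mulrC ler_wpM2r ?normc_ge0//.
rewrite (le_trans (ler_normcD _ _))// mulrDl lerD//; last by rewrite normcM mulrC.
apply: (le_trans eK); rewrite expr2 mulrA ler_wpM2r ?normc_ge0//.
apply: (@le_trans _ _ (`|K| * normc h)); last by rewrite ler_wpM2l// ltW.
by rewrite ler_wpM2r ?normc_ge0// ler_norm.
Qed.

(** The estimate for [f] is asked on a ball, so that [derive1 f] coincides with [f1] near [z] and
    inherits its estimate. *)
Lemma cderiv_est_twice (f f1 : R[i] -> R[i]) z l (r : R) : 0 < r ->
  (forall w, normc (w - z) < r -> cderiv_est f w (f1 w)) -> cderiv_est f1 z l ->
  [/\ twice_cderivable f z, derive1 f z = f1 z & derive1 (derive1 f) z = l].
Proof.
move=> r0 ff1 [K [s [s0 f1K]]].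
have df w : normc (w - z) < r -> derive1 f w = f1 w.
  by move=> /ff1 /cderiv_est_derive1[].
have zz : normc (z - z) < r by rewrite subrr normc0.
have est : cderiv_est (derive1 f) z l.
  exists K, (Num.min r s); split=> [|h]; first by rewrite lt_min r0.
  rewrite lt_min => /andP[hr hs]; rewrite !df ?f1K//.
  by rewrite addrC addKr.
have [d2 e2] := cderiv_est_derive1 est.
split=> //; last exact: df.
split=> //; apply/nbhs_ballP; exists r%:C; first by rewrite /= ltcR.
move=> w; rewrite /ball /= normr_normc ltcR normc_distrC => /ff1.
by move=> /cderiv_est_derive1[].
Qed.

Lemma taylor_continuous (phi psi : R -> R) (K : R) :
  (forall x y, `|phi (x + y) - phi x - y * psi x| <= K * y ^+ 2) -> continuous phi.
Proof.
move=> phiK x; apply/cvgrPdist_lt => e e0.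
have K0 : 0 <= K by have := phiK 0 1; rewrite expr1n mulr1; exact: le_trans.
pose s := Num.min 1 (e / (K + `|psi x| + 1)).
have M0 : 0 < K + `|psi x| + 1 by rewrite ltr_wpDl// addr_ge0.
have s0 : 0 < s by rewrite lt_min ltr01 divr_gt0.
exists s => //= y; rewrite /ball/= distrC => ys.
have := phiK x (y - x); rewrite (addrC x) subrK => H.
have y1 : `|y - x| <= 1 by rewrite ltW// (lt_le_trans ys)// ge_min lexx.
have ye : `|y - x| * (K + `|psi x| + 1) < e.
  by rewrite -ltr_pdivlMr// (lt_le_trans ys)// ge_min lexx orbT.
rewrite distrC -[phi y - phi x](subrK ((y - x) * psi x)).
rewrite (le_lt_trans (ler_normD _ _))// (le_lt_trans _ ye)//.
rewrite normrM; move: H; rewrite -[(y - x) ^+ 2]real_normK ?num_real//.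
move: y1 (normr_ge0 (y - x)) (normr_ge0 (psi x)).
set q := `|y - x|; set m := `|psi x| => q1 q0 m0 H.
have : K * q ^+ 2 <= K * q by rewrite ler_wpM2l// expr2 ler_piMl.
by move: H; rewrite !mulrDr mulr1 (mulrC q K); lra.
Qed.

Definition rderiv_est D (f : R -> R[i]) x (l : R[i]) := exists K r : R, 0 < r /\
  forall y, D y -> `|y - x| < r ->
    normc (f y - f x - (y - x)%:C * l) <= K * (y - x) ^+ 2.

Lemma rderiv_estD D (f g : R -> R[i]) x k l :
  rderiv_est D f x k -> rderiv_est D g x l ->
  rderiv_est D (fun y => f y + g y) x (k + l).
Proof.
move=> [K [r [r0 fK]]] [L [s [s0 gL]]]; exists (K + L), (Num.min r s).
split=> [|y Dy]; first by rewrite lt_min r0.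
rewrite lt_min => /andP[hr hs]; set e := (y - x)%:C.
have -> : f y + g y - (f x + g x) - e * (k + l) =
  (f y - f x - e * k) + (g y - g x - e * l) by ring.
by rewrite (le_trans (ler_normcD _ _))// mulrDl lerD ?fK ?gL.
Qed.

Lemma rderiv_estZ D (a : R[i]) (f : R -> R[i]) x l :
  rderiv_est D f x l -> rderiv_est D (fun y => a * f y) x (a * l).
Proof.
move=> [K [r [r0 fK]]]; exists (normc a * K), r; split=> // y Dy hr.
have -> : a * f y - a * f x - (y - x)%:C * (a * l) =
  a * (f y - f x - (y - x)%:C * l) by ring.
by rewrite normcM -mulrA ler_wpM2l ?normc_ge0 ?fK.
Qed.

Lemma rderiv_est_rderive D (f : R -> R[i]) x l : (forall y, x <= y -> D y) ->
  rderiv_est D f x l -> rderivable D f x /\ rderive D f x = l.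
Proof.
move=> Dx [K [r [r0 fK]]].
(* Each punctured ball meets [D] at [x + e / 2]; properness is what makes the limit unique. *)
have PF : ProperFilter (within D x^').
  apply: Build_ProperFilter_ex => A [e /= e0 eA].
  exists (x + e / 2); apply: eA => //=.
  - by rewrite /ball/= opprD addNKr normrN gtr0_norm ?divr_gt0// ltr_pdivrMr// ltr_pMr// ltr1n.
  - by rewrite -subr_eq0 addrAC subrr add0r gt_eqF// divr_gt0.
  - by apply: Dx; rewrite lerDl divr_ge0// ltW.
suff fl : diff_quotient f x @ within D x^' --> l.
  split; first by apply/cvg_ex; exists l.
  by rewrite /rderive; apply: norm_cvg_lim fl.
apply/cvg_normcP => e e0.
pose s := Num.min r (e / (`|K| + 1)).
have K1 : 0 < `|K| + 1 by rewrite ltr_wpDl.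
have s0 : 0 < s by rewrite lt_min r0 divr_gt0.
exists s => //= y; rewrite /ball/= distrC => ys yx Dy.
have yx0 : y - x != 0 by rewrite subr_eq0.
have yx0' : (y - x)%:C != 0 by rewrite fmorph_eq0.
have -> : l - diff_quotient f x y = - ((y - x)%:C^-1 * (f y - f x - (y - x)%:C * l)).
  by rewrite /diff_quotient fmorphV [in RHS]mulrBr mulKf// opprB.
rewrite normc_opp normcM normcV normc_real ltr_pdivrMl ?normr_gt0//.
have yr : `|y - x| < r by rewrite (lt_le_trans ys)// ge_min lexx.
apply: le_lt_trans (fK _ Dy yr) _.
rewrite -real_normK ?num_real// expr2 mulrA mulrC ltr_pM2l ?normr_gt0//.
apply: (@le_lt_trans _ _ (`|K| * `|y - x|)); first by rewrite ler_wpM2r// ler_norm.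
have : `|y - x| < e / (`|K| + 1) by rewrite (lt_le_trans ys)// ge_min lexx orbT.
by rewrite ltr_pdivlMr//; apply: le_lt_trans; rewrite mulrC ler_wpM2l// lerDl.
Qed.

Lemma rderiv_est_twice D (f f1 : R -> R[i]) x l :
  (forall y y' : R, D y -> y <= y' -> D y') -> D x ->
  (forall y, D y -> rderiv_est D f y (f1 y)) -> rderiv_est D f1 x l ->
  [/\ twice_rderivable D f x, rderive D f x = f1 x &
      rderive D (rderive D f) x = l].
Proof.
move=> Dup Dx ff1 [K [r [r0 f1K]]].
have df y : D y -> rderivable D f y /\ rderive D f y = f1 y.
  by move=> Dy; apply: rderiv_est_rderive; [move=> z; exact: Dup|exact: ff1].
have est : rderiv_est D (rderive D f) x l.
  exists K, r; split=> // y Dy yr.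
  by rewrite (df y Dy).2 (df x Dx).2; exact: f1K.
have [d2 e2] := rderiv_est_rderive (fun y => Dup x y Dx) est.
split=> //; last exact: (df x Dx).2.
split; last exact: d2.
by near=> y; apply: (df y _).1; near: y; exact: withinT.
Unshelve. all: by end_near. Qed.

(** Chain rule through [expi], whose derivative at [x] is ['i * expi x]; the radius [r / 3] offsets
    the Lipschitz constant 3. *)
Lemma cderiv_est_angle (f : R[i] -> R[i]) (a : R[i]) x l : normc a <= 1 ->
  cderiv_est f (a * expi x) l ->
  rderiv_est setT (fun y => f (a * expi y)) x ('i%C * (a * expi x * l)).
Proof.
move=> a1 [K [r [r0 fK]]]; exists (9 * `|K| + 3 * normc l), (r / 3).
split=> [|y _ yr]; first by rewrite divr_gt0.
set z := a * expi x in fK *; set e := y - x in yr *.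
have z1 : normc z <= 1 by rewrite normcM normc_expi mulr1.
pose h := z * (expi e - 1).
have -> : a * expi y = z + h.
  by rewrite /h /z mulrBr mulr1 addrC subrK -mulrA -expiD addrC subrK.
have he : normc h <= 3 * `|e|.
  by rewrite normcM -[leRHS]mul1r ler_pM ?normc_ge0// expi_lipschitz.
have hr : normc h < r by rewrite (le_lt_trans he)// mulrC -ltr_pdivlMr.
have ei : e *i = e%:C * ('i%C) :> R[i].
  by apply/eqP; rewrite eq_complex /= !mulr0 !mul0r subrr mulr1 addr0 !eqxx.
have -> : f (z + h) - f z - e%:C * ('i%C * (z * l)) =
    (f (z + h) - f z - h * l) + z * (expi e - 1 - e *i) * l.
  by rewrite /h ei; ring.
rewrite (le_trans (ler_normcD _ _))// mulrDl lerD//.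
  apply: le_trans (fK _ hr) _; apply: (@le_trans _ _ (`|K| * normc h ^+ 2)).
    by rewrite ler_wpM2r ?sqr_ge0// ler_norm.
  rewrite (mulrC 9) -mulrA ler_wpM2l// -[e ^+ 2]real_normK ?num_real//.
  rewrite (_ : 9 = 3 ^+ 2); last by ring.
  by rewrite -exprMn lerXn2r ?nnegrE ?normc_ge0// mulr_ge0.
rewrite normcM [leRHS]mulrAC ler_wpM2r ?normc_ge0// normcM -[leRHS]mul1r.
by rewrite ler_pM ?normc_ge0// expi_taylor.
Qed.

End derivative_estimates.

(** * Means of analytic families *)

Section families.
Context {R : realType} {d : measure_display} {T : measurableType d}.
Variables (P : probability T R) (lambda : R) (N : R -> T -> nat).
Hypotheses (lambda_gt0 : 0 < lambda) (N_poisson : poisson_process P lambda N).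
Variables (v : R).
Implicit Types (g : bool -> R[i] -> R[i]) (z h : R[i]) (t : R).

Local Notation X := (position N v).

Definition analytic_family g := forall b, analytic_on unit_disc (g b).

Definition euler_op g b z : R[i] := z * derive1 (g b) z.

(** The operator [L] on complex families. The difference is written with [-1 *] so that the closure
    lemmas for sums and multiples apply directly. *)
Definition telegraph_generator g b z : R[i] :=
  (v * (-1) ^+ (b : bool))%:C * 'i%C * euler_op g b z +
  lambda%:C * (g (~~ b) z + -1 * g b z).

Lemma analytic_family_euler g : analytic_family g -> analytic_family (euler_op g).
Proof. by move=> ga b; apply: analytic_mul_id; exact: analytic_derive1. Qed.

Lemma analytic_family_telegraph_generator g : analytic_family g -> analytic_family (telegraph_generator g).
Proof.
move=> ga b; apply: analyticD; apply: analyticZ; first exact: analytic_family_euler.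
by apply: analyticD => //; exact: analyticZ.
Qed.

(** Each derivative in [z] of [g (z * expi X)] brings out one factor [expi X], so the weight of
    order [k] accompanies the [k]-th derivative. *)
Definition weighted_mean (k : nat) g z t : R[i] :=
  cexpectation P (fun w => expi (X t w) ^+ k * g (odd (N t w)) (z * expi (X t w))).

Definition family_mean g z t : R[i] :=
  cexpectation P (fun w => g (odd (N t w)) (z * expi (X t w))).

(** [p] is meant to be the real or the imaginary part; its three properties let one proof serve
    both. *)
Lemma analytic_curve_state_deriv g z (p : R[i] -> R) : analytic_family g ->
  normc z < 1 -> (forall x y, p (x - y) = p x - p y) ->
  (forall (a : R) x, p (a%:C * x) = a * p x) -> (forall x, `|p x| <= normc x) ->
  state_deriv (fun b x => p (g b (z * expi x)))
    (fun b x => p ('i%C * euler_op g b (z * expi x))).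
Proof.
move=> ga z1 pB pZ ple.
(* Stated for every family because it serves for [g] and for ['i * euler_op g], whose continuity
   comes from its own Taylor bound. *)
have sd G : analytic_family G -> exists K : R, (forall b x, `|p (G b (z * expi x))| <= K) /\
    forall b x y, `|p (G b (z * expi (x + y))) - p (G b (z * expi x)) -
      y * p ('i%C * euler_op G b (z * expi x))| <= K * y ^+ 2.
  move=> Ga.
  have one b : exists K : R, (forall x, `|p (G b (z * expi x))| <= K) /\
    forall x y, `|p (G b (z * expi (x + y))) - p (G b (z * expi x)) -
      y * p ('i%C * euler_op G b (z * expi x))| <= K * y ^+ 2.
    have [K1 [r [_ K10 GK _]]] := analytic_circle_taylor (Ga b) z1.
    have [K2 GK2] := analytic_curve_taylor (Ga b) z1.
    exists (Num.max K1 K2); split=> [x|x y].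
      by rewrite (le_trans (ple _))// le_max GK.
    rewrite -pZ -!pB (le_trans (ple _))// (@le_trans _ _ (K2 * y ^+ 2))//; last first.
      by rewrite ler_wpM2r ?sqr_ge0// le_max lexx orbT.
    have -> : y%:C * ('i%C * euler_op G b (z * expi x)) =
        y *i * (z * expi x * derive1 (G b) (z * expi x)); last exact: GK2.
      rewrite mulrA; congr (_ * _); apply/eqP.
      by rewrite eq_complex /= !mulr0 !mul0r subrr mulr1 addr0 !eqxx.
  have [K1 [G1 T1]] := one true; have [K2 [G2 T2]] := one false.
  exists (Num.max K1 K2); split=> [[] x|[] x y]; rewrite ?le_max ?G1 ?G2 ?orbT//.
    by rewrite (le_trans (T1 _ _))// ler_wpM2r ?sqr_ge0// le_max lexx.
  by rewrite (le_trans (T2 _ _))// ler_wpM2r ?sqr_ge0// le_max lexx orbT.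
have sf G : analytic_family G -> state_fun (fun b x => p (G b (z * expi x))).
  move=> /sd[K [GK GT]]; split; last by exists K.
  by move=> b; exact: (taylor_continuous (GT b)).
split; first exact: sf; last by have [K [_ GT]] := sd g ga; exists K.
apply: (sf (fun b z => 'i%C * euler_op g b z)) => b; apply: analyticZ.
exact: analytic_family_euler.
Qed.

Lemma Re_curve_state_deriv g z : analytic_family g -> normc z < 1 ->
  state_deriv (fun b x => complex.Re (g b (z * expi x)))
    (fun b x => complex.Re ('i%C * euler_op g b (z * expi x))).
Proof.
move=> ga z1.
exact: analytic_curve_state_deriv ga z1 ReB Re_realM (@normr_Re_le _).
Qed.

Lemma Im_curve_state_deriv g z : analytic_family g -> normc z < 1 ->
  state_deriv (fun b x => complex.Im (g b (z * expi x)))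
    (fun b x => complex.Im ('i%C * euler_op g b (z * expi x))).
Proof.
move=> ga z1.
exact: analytic_curve_state_deriv ga z1 ImB Im_realM (@normr_Im_le _).
Qed.

(** The coefficients [v * (-1) ^+ b] and [lambda] are real, so [p] passes through them; the factor
    ['i] stays with the Euler operator. *)
Lemma state_generator_curve g z (p : R[i] -> R) :
  (forall x y, p (x - y) = p x - p y) ->
  (forall (a : R) x, p (a%:C * x) = a * p x) ->
  state_generator lambda v (fun b x => p (g b (z * expi x)))
    (fun b x => p ('i%C * euler_op g b (z * expi x))) =
  (fun b x => p (telegraph_generator g b (z * expi x))).
Proof.
move=> pB pZ; apply/funext => b; apply/funext => x; rewrite /telegraph_generator.
set e := euler_op _ _ _; set g1 := g (~~ b) _; set g2 := g b _.
have -> : (v * (-1) ^+ b)%:C * 'i%C * e + lambda%:C * (g1 + -1 * g2) =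
  (v * (-1) ^+ b)%:C * ('i%C * e) - lambda%:C * (g2 - g1) by ring.
by rewrite pB !pZ pB /state_generator -/e -/g1 -/g2; ring.
Qed.

Lemma family_mean_deriv g z t : analytic_family g -> normc z < 1 -> 0 <= t ->
  rderiv_est [set s | 0 <= s] (family_mean g z) t (family_mean (telegraph_generator g) z t).
Proof.
move=> ga z1 t0; have La := analytic_family_telegraph_generator ga.
have := Re_curve_state_deriv La z1; rewrite -(state_generator_curve _ _ ReB Re_realM).
move=> /(state_mean_two_sided lambda_gt0 N_poisson (Re_curve_state_deriv ga z1))[C1 H1].
have := Im_curve_state_deriv La z1; rewrite -(state_generator_curve _ _ ImB Im_realM).
move=> /(state_mean_two_sided lambda_gt0 N_poisson (Im_curve_state_deriv ga z1))[C2 H2].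
exists (C1 + C2), 1; split=> // s s0 /ltW st.
have := H1 _ _ t0 s0 st; have := H2 _ _ t0 s0 st.
rewrite (state_generator_curve _ _ ImB Im_realM) (state_generator_curve _ _ ReB Re_realM).
move=> I1 R1; rewrite (le_trans (normc_le_ReIm _))// mulrDl lerD//.
  by rewrite !ReB Re_realM /family_mean !cexpectationE.
by rewrite !ImB Im_realM /family_mean !cexpectationE.
Qed.

Lemma bounded_crv_curve g z t : analytic_family g -> normc z < 1 -> 0 <= t ->
  bounded_crv (fun w => g (odd (N t w)) (z * expi (X t w))).
Proof.
move=> ga z1 t0; split.
  have [sf _ _] := Re_curve_state_deriv ga z1.
  exact: (bounded_rv_state N_poisson v sf t0).
have [sf _ _] := Im_curve_state_deriv ga z1.
exact: (bounded_rv_state N_poisson v sf t0).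
Qed.

Lemma bounded_crv_expi t k : 0 <= t -> bounded_crv (fun w => expi (X t w) ^+ k).
Proof.
move=> t0; apply: bounded_crvX; split.
  apply: (@bounded_rv_state _ _ _ _ _ _ N_poisson v (fun=> cos)) => //.
  by split=> [_|]; [exact: continuous_cos|exists 1 => _ x; exact: cos_max].
apply: (@bounded_rv_state _ _ _ _ _ _ N_poisson v (fun=> sin)) => //.
by split=> [_|]; [exact: continuous_sin|exists 1 => _ x; exact: sin_max].
Qed.

(** Differentiation under the expectation: for each outcome a point of the circle of radius [|z|]
    moves by [h * expi X], of modulus [|h|], so the Taylor bound on the circle applies with one
    constant. *)
Lemma weighted_mean_cderiv k g z t : analytic_family g -> normc z < 1 -> 0 <= t ->
  cderiv_est (fun w => weighted_mean k g w t) z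
    (weighted_mean k.+1 (fun b => derive1 (g b)) z t).
Proof.
move=> ga z1 t0.
have [K1 [r1 [r10 K10 _ T1]]] := analytic_circle_taylor (ga true) z1.
have [K2 [r2 [r20 K20 _ T2]]] := analytic_circle_taylor (ga false) z1.
(* The radius [1 - normc z] keeps [z + h] in the disc, where the integrand is bounded; the factor 2
   is the one of [normc_cexpectation_le]. *)
exists (2 * Num.max K1 K2), (Num.min (Num.min r1 r2) (1 - normc z)).
split=> [|h]; first by rewrite !lt_min r10 r20 subr_gt0.
rewrite !lt_min => /andP[/andP[h1 h2] hz].
have dga : analytic_family (fun b => derive1 (g b)).
  by move=> b; exact: analytic_derive1.
have zh1 : normc (z + h) < 1.
  by rewrite (le_lt_trans (ler_normcD _ _))// addrC -ltrBrDr.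
have bU n : bounded_crv (fun w => expi (X t w) ^+ n) by exact: bounded_crv_expi.
have b1 := bounded_crvM (bU k) (bounded_crv_curve ga zh1 t0).
have b2 := bounded_crvM (bU k) (bounded_crv_curve ga z1 t0).
have b3 := bounded_crvM (bU k.+1) (bounded_crv_curve dga z1 t0).
have b12 := bounded_crvB b1 b2; have hb3 := bounded_crvZ h b3.
rewrite /weighted_mean -cexpectationZ// -!cexpectationB// -mulrA.
apply: normc_cexpectation_le; first exact: bounded_crvB.
move=> w; set e := expi _; set b := odd _.
have -> : e ^+ k * g b ((z + h) * e) - e ^+ k * g b (z * e) -
    h * (e ^+ k.+1 * derive1 (g b) (z * e)) =
    e ^+ k * (g b (z * e + h * e) - g b (z * e) - h * e * derive1 (g b) (z * e)).
  by rewrite (mulrDl z h e) (exprS e); ring.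
have he : normc (h * e) = normc h by rewrite normcM normc_expi mulr1.
rewrite normcM normcX normc_expi expr1n mul1r -he /e.
case: b; [apply: le_trans (T1 _ _ _) _|apply: le_trans (T2 _ _ _) _]; rewrite ?he//.
  by rewrite ler_wpM2r ?sqr_ge0// le_max lexx.
by rewrite ler_wpM2r ?sqr_ge0// le_max lexx orbT.
Qed.

Lemma weighted_mean0 g z t : weighted_mean 0 g z t = family_mean g z t.
Proof. by rewrite /weighted_mean; under eq_fun do rewrite expr0 mul1r. Qed.

Lemma derive1_euler_op g b z : analytic_family g -> normc z < 1 ->
  derive1 (euler_op g b) z = derive1 (g b) z + z * derive1 (derive1 (g b)) z.
Proof.
rewrite -unit_discE => ga z1; apply: (cderiv_est_derive1 _).2.
apply: cderiv_est_mul_id; apply: analytic_cderiv_est z1; exact: analytic_derive1.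
Qed.

Lemma derive1_generator g b z : analytic_family g -> normc z < 1 ->
  derive1 (telegraph_generator g b) z =
  (v * (-1) ^+ b)%:C * 'i%C * derive1 (euler_op g b) z +
  lambda%:C * (derive1 (g (~~ b)) z + -1 * derive1 (g b) z).
Proof.
rewrite -unit_discE => ga z1; apply: (cderiv_est_derive1 _).2.
have ea := analytic_family_euler ga.
apply: cderiv_estD; apply: cderiv_estZ; first exact: analytic_cderiv_est z1.
apply: cderiv_estD; last apply: cderiv_estZ; exact: analytic_cderiv_est z1.
Qed.

Lemma generator_telegraph g b z : analytic_family g -> normc z < 1 ->
  telegraph_generator (telegraph_generator g) b z + 2 * lambda%:C * telegraph_generator g b z =
  - v%:C ^+ 2 * euler_op (euler_op g) b z.
Proof.
move=> ga z1.
have -> : telegraph_generator (telegraph_generator g) b z =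
    (v * (-1) ^+ b)%:C * 'i%C * (z * derive1 (telegraph_generator g b) z) +
    lambda%:C * (telegraph_generator g (~~ b) z + -1 * telegraph_generator g b z) by [].
rewrite derive1_generator// /telegraph_generator negbK.
have -> : euler_op (euler_op g) b z = z * derive1 (euler_op g b) z by [].
have -> : euler_op g b z = z * derive1 (g b) z by [].
have -> : euler_op g (~~ b) z = z * derive1 (g (~~ b)) z by [].
(* This sign change cancels the terms in [D S] of the square. What remains, besides the term in
   [D ^ 2], is [-2 * lambda * L], since [(S - 1) ^ 2 = -2 * (S - 1)]. *)
have -> : (v * (-1) ^+ (~~ b))%:C = - (v * (-1) ^+ b)%:C :> R[i].
  by rewrite -rmorphN; congr (_%:C); case: b; rewrite /= ?expr0 ?expr1; ring.
have -> : v%:C ^+ 2 = (v * (-1) ^+ b)%:C ^+ 2 :> R[i].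
  by rewrite -!rmorphXn exprMn sqrr_sign mulr1.
have j2 : 'i%C ^+ 2 = -1 :> R[i] by exact: sqr_i.
move: (derive1 (euler_op g b) z) (derive1 (g b) z) (derive1 (g (~~ b)) z) (g b z) (g (~~ b) z)
  (v * _)%:C j2 => e2 e en f fn s; move: ('i%C) => j j2.
by ring: j2.
Qed.

(** With [e = expi X], the value of [D ^ 2 g] at [z * e] is [z * e * g' + z ^ 2 * e ^ 2 * g''], so
    the powers of [e] are the weights of the two means. *)
Lemma family_mean_telegraph g z t : analytic_family g -> normc z < 1 -> 0 <= t ->
  family_mean (telegraph_generator (telegraph_generator g)) z t +
    2 * lambda%:C * family_mean (telegraph_generator g) z t =
  - v%:C ^+ 2 *
    (z ^+ 2 * weighted_mean 2 (fun b => derive1 (derive1 (g b))) z t +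
     z * weighted_mean 1 (fun b => derive1 (g b)) z t).
Proof.
move=> ga z1 t0.
have La := analytic_family_telegraph_generator ga; have LLa := analytic_family_telegraph_generator La.
have d1a : analytic_family (fun b => derive1 (g b)) by move=> b; exact: analytic_derive1.
have d2a : analytic_family (fun b => derive1 (derive1 (g b))).
  by move=> b; exact: analytic_derive1.
have b1 := bounded_crvM (bounded_crv_expi 1 t0) (bounded_crv_curve d1a z1 t0).
have b2 := bounded_crvM (bounded_crv_expi 2 t0) (bounded_crv_curve d2a z1 t0).
have bL := bounded_crv_curve La z1 t0; have bLL := bounded_crv_curve LLa z1 t0.
have zb1 := bounded_crvZ z b1; have zb2 := bounded_crvZ (z ^+ 2) b2.
have lbL := bounded_crvZ (2 * lambda%:C) bL.
rewrite /family_mean /weighted_mean -(cexpectationZ P z b1).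
rewrite -(cexpectationZ P (z ^+ 2) b2) -(cexpectationD P zb2 zb1).
rewrite -(cexpectationZ P _ bL) -(cexpectationD P bLL lbL).
rewrite -(cexpectationZ P _ (bounded_crvD zb2 zb1)).
congr cexpectation; apply/funext => w.
have ze1 : normc (z * expi (X t w)) < 1 by rewrite normcM normc_expi mulr1.
rewrite generator_telegraph// {1}/euler_op derive1_euler_op//.
move: (derive1 (derive1 (g _)) _) => d2; move: (derive1 (g _) _) => d1.
by move: (expi _) v%:C => e c; ring.
Qed.

End families.

(** * The telegraph equation for the average over the two initial velocities *)

Theorem corollary3 (R : realType) (lambda c : R)
    (lambda_gt0 : 0 < lambda) (c_gt0 : 0 < c)
    (d : measure_display) (Omega : measurableType d)
    (P : probability Omega R) (N : R -> Omega -> nat)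
    (N_poisson : poisson_process P lambda N)
    (f : R[i] -> R -> R[i])
    (f_analytic : forall v, v = c \/ v = - c ->
      analytic_on unit_disc (fun z => f z v))
    (f_continuous : forall v, v = c \/ v = - c ->
      {within closed_unit_disc, continuous (fun z => f z v)}) :
  let u := telegraph_mean P N f in
  let p := fun (z : R[i]) (t : R) => (u z c t + u z (- c) t) / 2 in
  forall r theta t : R, 0 < r < 1 -> 0 <= theta < 2 * pi -> 0 <= t ->
  let z : R[i] := r%:C * expi theta in
  let p_time := fun s : R => p z s in
  let p_space := fun w : R[i] => p w t in
  let p_angle := fun a : R => p (r%:C * expi a) t in
  let times : set R := [set s | 0 <= s] in
  [/\ twice_rderivable times p_time t,
      twice_cderivable p_space z,
      twice_rderivable setT p_angle theta,
      rderive times (rderive times p_time) t +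
        2 * lambda%:C * rderive times p_time t =
      - c%:C ^+ 2 * (z ^+ 2 * derive1 (derive1 p_space) z +
                     z * derive1 p_space z)
    & - c%:C ^+ 2 * (z ^+ 2 * derive1 (derive1 p_space) z +
                     z * derive1 p_space z) =
      c%:C ^+ 2 * rderive setT (rderive setT p_angle) theta].
Proof.
move=> u p r theta t /andP[r0 r1] _ t0 z p_time p_space p_angle times.
(* The velocity started from [v] takes only the values [v] and [- v], so for [v = c] and [v = - c]
   both members of the family are analytic. *)
pose g (v : R) (b : bool) w := f w (v * (-1) ^+ b).
have ga v : v = c \/ v = - c -> analytic_family (g v).
  by move=> vc b; apply: f_analytic; case: b vc => -[] ->;
    rewrite ?expr1 ?expr0 ?mulrN1 ?mulr1 ?opprK; [right|left|left|right].
have gc : analytic_family (g c) by apply: ga; left.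
have gNc : analytic_family (g (- c)) by apply: ga; right.
have uE w v s : u w v s = family_mean P N v (g v) w s.
  by congr cexpectation; apply/funext => x; rewrite velocityE.
have pE w s : p w s = 2^-1 *
    (family_mean P N c (g c) w s + family_mean P N (- c) (g (- c)) w s).
  by rewrite /p !uE mulrC.
have rC : normc (r%:C : R[i]) = r by rewrite normc_real gtr0_norm.
have zr a : normc (r%:C * expi a) = r by rewrite normcM normc_expi mulr1.
have z1 : normc z < 1 by rewrite zr.
(* Candidate time derivatives, with [L] applied once and, in [A2], twice. *)
pose A1 s := 2^-1 * (family_mean P N c (telegraph_generator lambda c (g c)) z s +
  family_mean P N (- c) (telegraph_generator lambda (- c) (g (- c))) z s).
pose A2 s := 2^-1 *
  (family_mean P N c (telegraph_generator lambda c (telegraph_generator lambda c (g c))) z s +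
   family_mean P N (- c)
     (telegraph_generator lambda (- c) (telegraph_generator lambda (- c) (g (- c)))) z s).
have dp s : times s -> rderiv_est times p_time s (A1 s).
  move=> s0; have -> : p_time = fun s => 2^-1 * (family_mean P N c (g c) z s +
      family_mean P N (- c) (g (- c)) z s) by apply/funext => ?; exact: pE.
  by apply/rderiv_estZ/rderiv_estD; exact: family_mean_deriv.
have dA1 : rderiv_est times A1 t (A2 t).
  have Lc := analytic_family_telegraph_generator lambda c gc.
  have LNc := analytic_family_telegraph_generator lambda (- c) gNc.
  apply/rderiv_estZ/rderiv_estD.
    exact: (family_mean_deriv lambda_gt0 N_poisson _ Lc z1 t0).
  exact: (family_mean_deriv lambda_gt0 N_poisson _ LNc z1 t0).
have [T1 T2 T3] : [/\ twice_rderivable times p_time t,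
    rderive times p_time t = A1 t & rderive times (rderive times p_time) t = A2 t].
  by apply: rderiv_est_twice dp dA1 => // x y; exact: le_trans.
pose B1 w := 2^-1 *
  (weighted_mean P N c 1 (fun b => derive1 (g c b)) w t +
   weighted_mean P N (- c) 1 (fun b => derive1 (g (- c) b)) w t).
pose B2 w := 2^-1 *
  (weighted_mean P N c 2 (fun b => derive1 (derive1 (g c b))) w t +
   weighted_mean P N (- c) 2 (fun b => derive1 (derive1 (g (- c) b))) w t).
have dB0 w : normc w < 1 -> cderiv_est p_space w (B1 w).
  move=> w1; have -> : p_space = fun w => 2^-1 * (weighted_mean P N c 0 (g c) w t +
      weighted_mean P N (- c) 0 (g (- c)) w t).
    by apply/funext => ?; rewrite !weighted_mean0; exact: pE.
  by apply/cderiv_estZ/cderiv_estD; apply: (weighted_mean_cderiv N_poisson).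
have dB1 w : normc w < 1 -> cderiv_est B1 w (B2 w).
  have dc : analytic_family (fun b => derive1 (g c b)).
    by move=> b; exact: analytic_derive1.
  have dNc : analytic_family (fun b => derive1 (g (- c) b)).
    by move=> b; exact: analytic_derive1.
  move=> w1; apply/cderiv_estZ/cderiv_estD.
    exact: (weighted_mean_cderiv N_poisson _ _ dc w1 t0).
  exact: (weighted_mean_cderiv N_poisson _ _ dNc w1 t0).
have [S1 S2 S3] : [/\ twice_cderivable p_space z, derive1 p_space z = B1 z &
    derive1 (derive1 p_space) z = B2 z].
  apply: (@cderiv_est_twice _ p_space B1 z (B2 z) (1 - r)); last exact: dB1.
    by rewrite subr_gt0.
  move=> w wz; apply: dB0; rewrite -[w](subrK z) (le_lt_trans (ler_normcD _ _))//.
  by rewrite zr -ltrBrDr.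
pose j : R[i] := 'i%C.
have j2 : j ^+ 2 = -1 by exact: sqr_i.
pose C1 a := j * (r%:C * expi a * B1 (r%:C * expi a)).
have r1' : normc (r%:C : R[i]) <= 1 by rewrite rC ltW.
have dC0 a : setT a -> rderiv_est setT p_angle a (C1 a).
  by move=> _; apply: (cderiv_est_angle (f := p_space) r1'); apply: dB0; rewrite zr.
(* [C1] is itself the restriction to the circle of [j * (w * B1 w)], so the same chain rule gives
   the second angular derivative. *)
have dC1 : rderiv_est setT C1 theta (j * (z * (j * (B1 z + z * B2 z)))).
  apply: (cderiv_est_angle (f := fun w => j * (w * B1 w)) r1').
  by apply/cderiv_estZ/cderiv_est_mul_id/dB1; rewrite zr.
have [H1 H2 H3] : [/\ twice_rderivable setT p_angle theta,
    rderive setT p_angle theta = C1 theta &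
    rderive setT (rderive setT p_angle) theta = j * (z * (j * (B1 z + z * B2 z)))].
  exact: rderiv_est_twice dC0 dC1.
split; [exact: T1|exact: S1|exact: H1| |].
- rewrite T3 T2 S3 S2.
  have Ec := family_mean_telegraph N_poisson c gc z1 t0.
  have ENc := family_mean_telegraph N_poisson (- c) gNc z1 t0.
  (* Only the square of the initial velocity enters, so both means satisfy the same linear equation
     and so does their average. *)
  rewrite rmorphN sqrrN in ENc.
  have avg (q a2 b2 l a1 b1 k x1 y1 x2 y2 w : R[i]) :
      a2 + l * a1 = - k * (w ^+ 2 * x2 + w * x1) ->
      b2 + l * b1 = - k * (w ^+ 2 * y2 + w * y1) ->
      q * (a2 + b2) + l * (q * (a1 + b1)) =
      - k * (w ^+ 2 * (q * (x2 + y2)) + w * (q * (x1 + y1))).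
    move=> ea eb; transitivity (q * ((a2 + l * a1) + (b2 + l * b1))); first by ring.
    by rewrite ea eb; ring.
  exact: avg Ec ENc.
- rewrite H3 S3 S2; move: (B1 z) (B2 z) c%:C => x y k.
  by move: (z) (j) j2 => z0 j0 j2; ring: j2.
Qed.
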